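(* If $G$ is a connected planar graph with at least $3$ vertices, then $\lambda(G)-1\leq \lambda_3(G)\leq \lambda(G)$.
   Context: All graphs are undirected, finite and simple. $\lambda(G)$ is the edge-connectivity of $G$. For a graph $G$ and a set $S\subseteq V(G)$ of at least two vertices, a tree connecting $S$ is a subgraph $T$ of $G$ that is a tree with $S\subseteq V(T)$. Let $\lambda(S)$ be the maximum number of pairwise edge-disjoint trees connecting $S$ in $G$. The generalized $3$-edge-connectivity of $G$ is $\lambda_3(G)=\min\{\lambda(S) : S\subseteq V(G),\ |S|=3\}$. *)

(* Defs.v *)
From HB Require Import structures.
From mathcomp Require Import all_boot all_order all_algebra.
From mathcomp Require Import boolp.

Set Implicit Arguments.
Unset Strict Implicit.
Unset Printing Implicit Defensive.

Local Open Scope set_scope.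

(* A finite simple graph is a symmetric irreflexive relation on a finType;
   an edge is the 2-element set of its ends. *)
Section EdgeSets.

Variable V : finType.
Implicit Types (W : {set V}) (F : {set {set V}}).

Definition edges (adj : rel V) : {set {set V}} :=
  [set [set z.1; z.2] | z : V * V & adj z.1 z.2].

Definition edge_rel F : rel V := fun x y => [set x; y] \in F.

Definition edge_connected F W : Prop :=
  {in W &, forall x y, connect (edge_rel F) x y}.

Definition acyclic F : Prop :=
  forall p : seq V, 2 < size p -> uniq p -> ~~ cycle (edge_rel F) p.

(* A subgraph is the pair of its vertex set and its edge set. *)
Definition subgraph_type : finType := ({set V} * {set {set V}})%type.

End EdgeSets.

Section Graphs.

Variables (V : finType) (adj : rel V).
Implicit Types (S : {set V}) (T : subgraph_type V).

Definition graph_connected : Prop := edge_connected (edges adj) [set: V].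

Definition is_subgraph T : Prop :=
  T.2 \subset edges adj /\ {in T.2, forall d : {set V}, d \subset T.1}.

Definition is_tree T : Prop :=
  [/\ T.1 != set0, edge_connected T.2 T.1 & acyclic T.2].

Definition tree_connecting S T : Prop :=
  [/\ is_subgraph T, is_tree T & S \subset T.1].

Definition tree_packing S (P : {set subgraph_type V}) : Prop :=
  {in P, forall T, tree_connecting S T} /\
  {in P &, forall T1 T2, T1 != T2 -> [disjoint T1.2 & T2.2]}.

(* When S has at least two vertices every tree connecting S has an edge, so
   counting sets of trees is the same as counting families of trees. *)
Definition lambda_set S : nat :=
  \max_(P : {set subgraph_type V} | `[< tree_packing S P >]) #|P|.

(* The default #|edges adj| bounds lambda_set S as soon as #|S| >= 2, so it
   does not affect the minimum when the graph has at least 3 vertices. *)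
Definition lambda3 : nat :=
  \big[minn/#|edges adj|]_(S : {set V} | #|S| == 3) lambda_set S.

(* With at least two vertices, deleting all the edges disconnects the graph, so
   the default #|edges adj| is one of the values being minimized. *)
Definition edge_connectivity : nat :=
  \big[minn/#|edges adj|]_(F : {set {set V}} | (F \subset edges adj) &&
     `[< ~ edge_connected (edges adj :\: F) [set: V] >]) #|F|.

End Graphs.

From mathcomp Require Import all_classical all_reals all_analysis.

Section Planarity.
Import Order.TTheory GRing.Theory Num.Theory.
Import numFieldNormedType.Exports.
Local Open Scope classical_set_scope.
Local Open Scope ring_scope.

Variables (R : realType) (V : finType) (adj : rel V).

(* The edge d is drawn as the simple arc curve d restricted to [0, 1]; only the
   values on [0, 1] for actual edges d matter. *)
Record plane_embedding (point : V -> R * R) (curve : {set V} -> R -> R * R) :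
    Prop := PlaneEmbedding {
  point_inj : injective point;
  curve_continuous : forall d, d \in edges adj ->
    {within `[0, 1], continuous (curve d)};
  curve_inj : forall d, d \in edges adj ->
    {in `[0, 1] &, injective (curve d)};
  curve_ends : forall d, d \in edges adj -> exists x y : V,
    [/\ d = [set x; y]%SET, curve d 0 = point x & curve d 1 = point y];
  curve_avoids_points : forall d, d \in edges adj -> forall (t : R) (x : V),
    0 < t < 1 -> curve d t <> point x;
  curve_disjoint : forall d1 d2, d1 \in edges adj -> d2 \in edges adj ->
    d1 != d2 -> forall s t : R, 0 < s < 1 -> 0 < t < 1 ->
    curve d1 s <> curve d2 t
}.

Definition planar : Prop :=
  exists (point : V -> R * R) (curve : {set V} -> R -> R * R),
    plane_embedding point curve.

End Planarity.

(* Main.v *)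
Require Import Defs.
From HB Require Import structures.
From mathcomp Require Import all_boot all_order all_algebra.
From mathcomp Require Import boolp zify ring lra.
From Stdlib Require Import Btauto.

(* The upper bound holds because every tree connecting a set that is separated by
   an edge cut uses an edge of the cut.

   For the lower bound let k be the edge-connectivity. If k <= 5, then for any
   three terminals there are k - 1 disjoint connecting edge sets, even in
   multigraphs in which only the cuts isolating one terminal have size >= k: an
   edge without terminal end is deleted, unless it crosses a tight set, which is
   contracted to its terminal (by Menger's theorem packings of the contraction
   lift). Once every edge has a terminal end, splitting off at the other vertices
   leaves stars and a triangle with multiplicities, where one counts.

   Planarity gives k <= 5: otherwise all degrees are at least 6, so there is a K5
   minor by Mader's argument (a minimal minor with at least 3n - 5 edges has every
   edge in three triangles). But K5 minors are not planar: after replacing the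
   arcs by sequences of close points, count modulo 2, for each of the 15 pairs of
   independent edges of K5, the ends of either edge lying below the other edge.
   Independent edges are far apart, so that each count is determined by the order
   in which the four abscissas occur; summing up, 0 = 5 modulo 2. *)

Set Implicit Arguments.
Unset Strict Implicit.
Unset Printing Implicit Defensive.

Local Open Scope set_scope.

(** * Multigraphs: cuts, links, Menger's theorem and contraction *)

Section Multigraph.
Variables (V E : finType).
Implicit Types (s t : E -> V) (F G : {set E}) (X Y : {set V}).

(** A multigraph is a set of edge names with two end maps. Contraction and splitting off change only
    the maps, so edge sets of the new graph are edge sets of the old one; loops cross nothing. *)
Definition crosses s t X (e : E) : bool := (s e \in X) (+) (t e \in X).

Definition cut s t F X : nat := \sum_(e in F) crosses s t X e.

Definition out s t X (e : E) : bool := (s e \in X) && (t e \notin X).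

Definition outcut s t F X : nat := \sum_(e in F) out s t X e.

(** Lying in one component of [F], in dual form: lifting a link from a split or contracted graph
    then means finding one crossing edge for each [X], with no paths to rebuild. *)
Definition linked s t F (u v : V) : Prop :=
  forall X, u \in X -> v \notin X -> exists2 e, e \in F & crosses s t X e.

Definition packing (k : nat) F (H : 'I_k -> {set E}) : Prop :=
  (forall i, H i \subset F) /\ (forall i j, i != j -> [disjoint H i & H j]).

Lemma cutD1 s t F X e : e \in F ->
  cut s t F X = crosses s t X e + cut s t (F :\ e) X.
Proof. by move=> eF; rewrite /cut (big_setD1 e). Qed.

Lemma outcutD1 s t F X e : e \in F ->
  outcut s t F X = out s t X e + outcut s t (F :\ e) X.
Proof. by move=> eF; rewrite /outcut (big_setD1 e). Qed.

Lemma linked_refl s t F u : linked s t F u u.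
Proof. by move=> X ->. Qed.

Lemma linked_sym s t F u v : linked s t F u v -> linked s t F v u.
Proof.
move=> uv X vX uX; have [||e eF ce] := uv (~: X); rewrite ?inE ?vX //.
by exists e => //; move: ce; rewrite /crosses !inE; do 2 case: (_ \in X).
Qed.

Lemma linked_trans s t F u v w :
  linked s t F u v -> linked s t F v w -> linked s t F u w.
Proof. by move=> uv vw X uX wX; case: (boolP (v \in X)) => vX; auto. Qed.

Lemma linked_edge s t F e : e \in F -> linked s t F (s e) (t e).
Proof. by move=> eF X sX tX; exists e; rewrite // /crosses sX (negbTE tX). Qed.

Lemma packing0 F : @packing 0 F (fun=> set0).
Proof. by split=> -[]. Qed.

Lemma packing_sub k F F' (H : 'I_k -> {set E}) :
  F \subset F' -> packing F H -> packing F' H.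
Proof. by move=> FF' [HF Hd]; split=> // i; apply: subset_trans FF'. Qed.

Lemma packing_cons k F G (H : 'I_k -> {set E}) :
  [disjoint F & G] -> packing F H ->
  packing (G :|: F) (fun i : 'I_k.+1 => if unlift ord0 i is Some j then H j else G).
Proof.
move=> dFG [HF Hd]; split=> [i|i j].
  case: unliftP => [j _|_]; last exact: subsetUl.
  exact/(subset_trans (HF j))/subsetUr.
case: unliftP => [i' ->|->]; case: unliftP => [j' ->|->] //.
- by move=> ij; apply: Hd; apply: contra_neq ij => ->.
- by move=> _; apply: disjointWl dFG.
- by move=> _; rewrite disjoint_sym; apply: disjointWl dFG.
Qed.

(* Splitting off: retargeting [e] to the head of [f] replaces the two
   consecutive arcs [e], [f] by a single one; a link of the new graph through
   [e] is lifted by adding [f]. *)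
Lemma linked_split s t (H : {set E}) e f u v :
  t e = s f ->
  linked s (fun g => if g == e then t f else t g) H u v ->
  linked s t (if e \in H then f |: H else H) u v.
Proof.
move=> tesf HL X uX vX; have [g gH] := HL X uX vX.
rewrite /crosses; case: (eqVneq g e) => [ge|ge] cg; last first.
  by exists g => //; case: ifP => // _; rewrite !inE gH orbT.
subst g; rewrite gH.
case: (boolP (crosses s t X e)) => [ce|]; first by exists e; rewrite // !inE gH orbT.
move=> ce; exists f; first by rewrite !inE eqxx.
move: cg ce; rewrite /crosses tesf.
by case: (s e \in X); case: (s f \in X); case: (t f \in X).
Qed.

Lemma packing_split k F (H : 'I_k -> {set E}) e f :
  f \in F -> packing (F :\ f) H ->
  packing F (fun i => if e \in H i then f |: H i else H i).
Proof.
move=> fF [HF Hd].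
have fH i : f \notin H i.
  by apply/negP => /(subsetP (HF i)); rewrite !inE eqxx.
have HF' i : H i \subset F by apply: subset_trans (HF i) (subsetDl _ _).
split=> [i|i j ij].
  by case: ifP => // _; rewrite subUset sub1set fF HF'.
have dij := Hd _ _ ij.
case: ifP => ei; case: ifP => ej //.
- by have /pred0P/(_ e) := dij; rewrite /= ei ej.
- rewrite disjoints_subset subUset sub1set inE fH -disjoints_subset.
  by rewrite dij.
- rewrite disjoint_sym disjoints_subset subUset sub1set inE fH -disjoints_subset.
  by rewrite disjoint_sym dij.
Qed.

Lemma outcut_submod s t F X Y :
  outcut s t F (X :&: Y) + outcut s t F (X :|: Y) <=
  outcut s t F X + outcut s t F Y.
Proof.
rewrite /outcut -!big_split; apply: leq_sum => e _; rewrite /out !inE.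
by do 4 case: (_ \in _).
Qed.

(** Induction on the number of arcs: an arc [e] leaving [a] is used as a whole path if it ends in
    [z], is deleted if all cuts stay large, and is otherwise split off with a well-chosen next arc
    [f]. *)
Lemma directed_menger s t F (k : nat) (a z : V) :
  a != z ->
  (forall X, a \in X -> z \notin X -> k <= outcut s t F X) ->
  exists2 H : 'I_k -> {set E}, packing F H & forall i, linked s t (H i) a z.
Proof.
move=> az; move: {2}#|F| (leqnn #|F|) => n.
elim: n F t k => [|n IHn] F t [|k] Fn cutk;
  try by exists (fun=> set0); [exact: packing0 | case].
  have := cutk [set a]; rewrite !inE eqxx eq_sym az => /(_ isT isT).
  by move: Fn; rewrite leqn0 cards_eq0 => /eqP->; rewrite /outcut big_set0.
have [e eF /andP[/eqP sea tea]] : exists2 e, e \in F & (s e == a) && (t e != a).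
  case: (pickP [pred e in F | (s e == a) && (t e != a)]).
    by move=> e /andP[eF He]; exists e.
  move=> F0; have := cutk [set a]; rewrite !inE eqxx eq_sym az => /(_ isT isT).
  by rewrite /outcut big1 // => e eF; have := F0 e; rewrite /= eF /= /out !inE => ->.
have Fe : #|F :\ e| <= n by move: Fn; rewrite (cardsD1 e) eF.
have [tez|tez] := eqVneq (t e) z.
  have [X aX zX|H Hp HL] := IHn (F :\ e) t k Fe.
    have := cutk X aX zX; rewrite (outcutD1 s t X eF).
    by case: (out _ _ _ _); lia.
  exists (fun i : 'I_k.+1 => if unlift ord0 i is Some j then H j else [set e]).
    have -> : F = [set e] :|: (F :\ e) by rewrite setD1K.
    by apply: packing_cons => //; rewrite disjoint_sym disjoints1 !inE eqxx.
  move=> i; case: unliftP => [j _|_]; first exact: HL.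
  by rewrite -sea -tez; apply: linked_edge; rewrite inE.
(* The tight sets are those for which [e] cannot be deleted. *)
pose tight := [pred X : {set V} | [&& a \in X, z \notin X, t e \notin X & outcut s t F X == k.+1]].
have [X0 tX0|no_tight] := pickP tight; last first.
  have [X aX zX|H Hp HL] := IHn (F :\ e) t k.+1 Fe; last first.
  - by exists H => //; apply: packing_sub Hp; apply: subsetDl.
  have := cutk X aX zX; rewrite (outcutD1 s t X eF) /out sea aX /=.
  case: (boolP (t e \in X)) => //= teX.
  have := no_tight X; rewrite /= aX zX teX /= (outcutD1 s t X eF) /out sea aX teX /=.
  by lia.
have [X /and4P[aX zX teX /eqP cX] Xmax] := arg_maxnP (fun X : {set V} => #|X|) tX0.
(* By submodularity the union of two tight sets is tight, so the largest one contains all others. *)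
have Xunion Y : tight Y -> Y \subset X.
  move=> /and4P[aY zY teY /eqP cY].
  have : tight (X :|: Y).
    rewrite /tight /= !inE aX (negbTE zX) (negbTE zY) (negbTE teX) (negbTE teY) /=.
    have c1 : k.+1 <= outcut s t F (X :&: Y).
      by apply: cutk; rewrite !inE ?aX ?aY // (negbTE zX).
    have c2 : k.+1 <= outcut s t F (X :|: Y).
      by apply: cutk; rewrite !inE ?aX ?aY // (negbTE zX) (negbTE zY).
    have := outcut_submod s t F X Y; move: c1 c2 cX cY; clear; lia.
  move=> /Xmax /= XYle.
  have /eqP -> : X == X :|: Y by rewrite eqEcard subsetUl.
  exact: subsetUr.
(* If no such [f] existed, adding [t e] to the tight set [X] would lose the arc [e] and gain none,
   giving too small a cut. *)
have [f fF /andP[/eqP sf tfX]] : exists2 f, f \in F & (s f == t e) && (t f \notin t e |: X).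
  case: (pickP [pred f in F | (s f == t e) && (t f \notin t e |: X)]).
    by move=> f /andP[fF Hf]; exists f.
  move=> noF; have := cutk (t e |: X).
  rewrite !inE aX orbT (negbTE zX) orbF eq_sym tez => /(_ isT isT).
  rewrite leqNgt => /negP[]; rewrite -cX (outcutD1 s t X eF).
  rewrite (outcutD1 _ _ _ eF) /out sea aX teX !inE eqxx /= andbF add0n add1n ltnS.
  apply: leq_sum => g; rewrite !inE => /andP[ge gF].
  have := noF g; rewrite /= gF /= /out !inE.
  case: (eqVneq (s g) (t e)) => [->|_] /=.
    by rewrite (negbTE teX) => /negbFE ->.
  by move=> _; case: (s g \in X) => //=; case: (_ == _) => //=; case: (t g \in X).
have fe : f != e by apply: contraNneq tea => fe; rewrite -sf fe sea.
have Ff : #|F :\ f| <= n by move: Fn; rewrite (cardsD1 f) fF.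
(* Splitting off lowers, by one, only the outcuts of sets containing [a] and [t f] but not [t e]. If
   such a set had outcut [k.+1] it would be tight, hence inside [X], which avoids [t f]. *)
pose t' g := if g == e then t f else t g.
have [Y aY zY|H Hp HL] := IHn (F :\ f) t' k.+1 Ff; last first.
- exists (fun i => if e \in H i then f |: H i else H i); first exact: packing_split.
  by move=> i; apply: linked_split; [rewrite sf|exact: HL].
have eFf : e \in F :\ f by rewrite !inE eq_sym fe.
have eqo : outcut s t' (F :\ f :\ e) Y = outcut s t (F :\ f :\ e) Y.
  by apply: eq_bigr => g; rewrite !inE => /andP[ge _]; rewrite /out /t' (negbTE ge).
have cY := cutk Y aY zY.
have := cY; rewrite (outcutD1 _ _ _ fF) (outcutD1 _ _ _ eFf).
rewrite (outcutD1 _ t' _ eFf) eqo /out sf sea aY /= /t' eqxx.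
set m := outcut s t (F :\ f :\ e) Y.
case: (boolP (t e \in Y)) => teY /=; first by rewrite !add0n.
case: (boolP (t f \in Y)) => tfY /=; last by rewrite !add0n.
have : outcut s t F Y != k.+1.
  apply/negP => cYk; have /Xunion /subsetP /(_ _ tfY) : tight Y.
    by rewrite /tight /= aY zY teY cYk.
  by move=> tfX'; move: tfX; rewrite !inE tfX' orbT.
rewrite (outcutD1 _ _ _ fF) (outcutD1 _ _ _ eFf) /out sf sea aY teY tfY /= -/m.
by clearbody m; clear; lia.
Qed.

Lemma cutE s t F X : cut s t F X = #|[set e in F | crosses s t X e]|.
Proof.
rewrite /cut -sum1_card big_mkcond [RHS]big_mkcond; apply: eq_bigr => e _.
by rewrite inE; case: (e \in F); case: crosses.
Qed.

Lemma linked_crosses s t s' t' F u v :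
  (forall X e, crosses s' t' X e = crosses s t X e) ->
  linked s' t' F u v -> linked s t F u v.
Proof.
by move=> cE uv X uX vX; have [e eF ce] := uv X uX vX; exists e; rewrite -?cE.
Qed.

(* The edges of [U] are undirected, those of [F :\: U] are oriented. *)
Definition mixcut s t F (U : {set E}) X : nat :=
  \sum_(e in F) (out s t X e || (e \in U) && out t s X e).

(* If both orientations of an edge were harmful, its two tight sets would
   contradict submodularity. *)
Lemma orientation s t F (U : {set E}) (k : nat) (a z : V) :
  (forall X, a \in X -> z \notin X -> k <= mixcut s t F U X) ->
  exists s' t', (forall X e, crosses s' t' X e = crosses s t X e) /\
    forall X, a \in X -> z \notin X -> k <= outcut s' t' F X.
Proof.
move: {2}#|U| (leqnn #|U|) => n; elim: n U s t => [|n IHn] U s t Un cutk.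
  exists s, t; split=> // X aX zX; apply: leq_trans (cutk X aX zX) _.
  move: Un; rewrite leqn0 cards_eq0 => /eqP->.
  by apply: leq_sum => e _; rewrite inE /= orbF.
have [U0|[e eU]] := set_0Vmem U; first by apply: (IHn U) => //; rewrite U0 cards0.
have Ue : #|U :\ e| <= n by move: Un; rewrite (cardsD1 e) eU.
pose s' g := if g == e then t g else s g.
pose t' g := if g == e then s g else t g.
have cE X g : crosses s' t' X g = crosses s t X g.
  by rewrite /crosses /s' /t'; case: eqP => // _; rewrite addbC.
have [/forallP good1|] := boolP [forall X : {set V},
    (a \in X) ==> (z \notin X) ==> (k <= mixcut s t F (U :\ e) X)].
  apply: (IHn (U :\ e)) => // X aX zX.
  by have := good1 X; rewrite aX zX.
rewrite negb_forall => /existsP[X]; rewrite !negb_imply -ltnNge => /and3P[aX zX cX].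
have [/forallP good2|] := boolP [forall X : {set V},
    (a \in X) ==> (z \notin X) ==> (k <= mixcut s' t' F (U :\ e) X)].
  have [||s1 [t1 [cE1 cut1]]] := IHn (U :\ e) s' t' => //.
    by move=> Y aY zY; have := good2 Y; rewrite aY zY.
  by exists s1, t1; split=> // Y g; rewrite cE1 cE.
rewrite negb_forall => /existsP[Y]; rewrite !negb_imply -ltnNge => /and3P[aY zY cY].
have XE : out t s X e.
  apply: contraLR (cutk X aX zX); rewrite -ltnNge => outX; apply: leq_ltn_trans cX.
  apply: leq_sum => g _; rewrite !inE; case: eqP => [->|_] //=.
  by rewrite (negbTE outX) andbF.
have YE : out s t Y e.
  apply: contraLR (cutk Y aY zY); rewrite -ltnNge => outY; apply: leq_ltn_trans cY.
  apply: leq_sum => g _; rewrite !inE /s' /t' /out; case: eqP => [->|_] //=.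
  by move: outY; rewrite /out; do 3 case: (_ \in _).
(* Uncrossing [X] and [Y]: [X] contains only [t e] and [Y] only [s e], so the intersection has
   neither end of [e] and the union has both, and [e] counts on neither side. *)
have: k + k < k + k; last by rewrite ltnn.
have aXY : a \in X :&: Y by rewrite inE aX.
have zXY : z \notin X :&: Y by rewrite inE (negbTE zX).
have aXUY : a \in X :|: Y by rewrite inE aX.
have zXUY : z \notin X :|: Y by rewrite inE (negbTE zX).
apply: leq_ltn_trans (leq_add (cutk _ aXY zXY) (cutk _ aXUY zXUY)) _.
have: mixcut s t F (U :\ e) X + mixcut s' t' F (U :\ e) Y < k + k.
  by rewrite -addSn leq_add // ltnW.
apply: leq_ltn_trans; rewrite /mixcut -!big_split; apply: leq_sum => g _ /=.
move: XE YE; rewrite /out !inE /s' /t'; case: (eqVneq g e) => [->|_] /=.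
  by do !case: (_ \in _) => //=.
by move=> _ _; do !case: (_ \in _) => //=.
Qed.

(** All edges start undirected; [orientation] directs them with every cut preserved, and links
    ignore directions. *)
Lemma menger s t F (k : nat) (a z : V) :
  a != z ->
  (forall X, a \in X -> z \notin X -> k <= cut s t F X) ->
  exists2 H : 'I_k -> {set E}, packing F H & forall i, linked s t (H i) a z.
Proof.
move=> az cutk; have [X aX zX|s' [t' [cE cutk']]] := @orientation s t F setT k a z.
  apply: leq_trans (cutk X aX zX) _; apply: leq_sum => e _.
  by rewrite /crosses /out inE; do 2 case: (_ \in _).
have [H Hp HL] := directed_menger az cutk'.
by exists H => // i; apply: linked_crosses (HL i).
Qed.

(** Contraction of [Y] to [a], to be composed with the end maps; edges inside [Y] become loops. *)
Definition collapse Y (a v : V) : V := if v \in Y then a else v.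

Lemma cut_collapse s t F Y a X :
  cut (collapse Y a \o s) (collapse Y a \o t) F X =
  cut s t F [set v | collapse Y a v \in X].
Proof. by apply: eq_bigr => e _; rewrite /crosses !inE. Qed.

(* By Menger's theorem the edges leaving the tight set [Y] are joined to [a] by
   disjoint links inside [Y], so sets of edges of the contraction extend to [G]. *)
Lemma collapse_lift s t F Y (a z : V) p (G : 'I_p -> {set E}) :
  a \in Y -> z \notin Y ->
  (forall X, a \in X -> X \subset Y -> cut s t F Y <= cut s t F X) ->
  packing F G ->
  exists2 G' : 'I_p -> {set E}, packing F G' &
    forall i u v, (u \in Y -> u = a) -> (v \in Y -> v = a) ->
      linked (collapse Y a \o s) (collapse Y a \o t) (G i) u v ->
      linked s t (G' i) u v.
Proof.
move=> aY zY Ymin [GF Gd].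
have az : a != z by apply: contraNneq zY => <-.
(* The complementary contraction, of everything outside [Y] to [z]. Since [Y] has the smallest cut,
   Menger's theorem gives as many disjoint links from [a] to [z] as there are edges leaving [Y], so
   each link contains exactly one of these edges. *)
pose r v := if v \in Y then v else z.
have [X aX zX|H [HF Hd] HL] := @menger (r \o s) (r \o t) F (cut s t F Y) a z az.
  have := Ymin (X :&: Y); rewrite inE aX aY subsetIr => /(_ isT isT) /leq_trans -> //.
  apply: leq_sum => e _; rewrite /crosses /r !inE /=.
  case: ifP => sY; case: ifP => tY; rewrite ?andbT ?andbF ?(negbTE zX) //.
have Huniq j j' e : e \in H j -> e \in H j' -> j = j'.
  move=> ej ej'; apply: contraTeq ej' => /Hd; rewrite disjoint_subset => /subsetP.
  by move=> /(_ _ ej).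
pose D := [set e in F | crosses s t Y e].
have crossr e : crosses (r \o s) (r \o t) Y e = crosses s t Y e.
  rewrite /crosses /r /=.
  case: (boolP (s e \in Y)) => sY; case: (boolP (t e \in Y)) => tY;
    by rewrite ?sY ?tY ?(negbTE sY) ?(negbTE tY) ?(negbTE zY).
have /fin_all_exists[c cP] : forall j, exists e, e \in H j :&: D.
  move=> j; have [e ej] := HL j Y aY zY.
  by rewrite crossr => ce; exists e; rewrite !inE ej ce (subsetP (HF j)).
have cH j : c j \in H j by have := cP j; rewrite inE => /andP[].
have c_inj : injective c.
  by move=> j j' cc; apply: (Huniq j j' (c j)) => //; rewrite cc.
have cD : [set c j | j : 'I_(cut s t F Y)] = D.
  have cardD : #|D| = cut s t F Y by rewrite cutE.
  apply/eqP; rewrite eqEcard card_imset // card_ord cardD leqnn andbT.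
  by apply/subsetP => e /imsetP[j _ ->]; have := cP j; rewrite inE => /andP[].
have D_uniq j e e' : e \in H j -> e' \in H j -> e \in D -> e' \in D -> e = e'.
  rewrite -cD => ej ej' /imsetP[i _ ei] /imsetP[i' _ ei'].
  have -> : e = c i by [].
  have -> : e' = c i' by [].
  have -> : i = j by apply: (Huniq _ _ e) => //; rewrite ei.
  by have -> : i' = j by apply: (Huniq _ _ e') => //; rewrite ei'.
pose inY e := (s e \in Y) && (t e \in Y).
(* Edges of [G i] not inside [Y] are kept; inside [Y], where they were loops, they are replaced by
   the links whose boundary edge lies in [G i]. *)
pose G' i := [set f in F | if inY f
  then [exists j, [exists e in G i :&: D, (e \in H j) && (f \in H j)]]
  else f \in G i].
exists G'.
  split=> [i|i i' ii']; first by apply/subsetP => f; rewrite inE => /andP[].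
  rewrite -setI_eq0; apply/eqP/setP => f; rewrite !inE; apply/negP.
  move=> /andP[/andP[_ fi] /andP[_ fi']]; move: fi fi'; case: (inY f); last first.
    by move=> fi fi'; have /pred0P/(_ f)/= := Gd i i' ii'; rewrite fi fi'.
  move=> /existsP[j /existsP[e /and3P[]]]; rewrite inE => /andP[eG eD] ej fj.
  move=> /existsP[j' /existsP[e' /and3P[]]]; rewrite inE => /andP[eG' eD'] ej' fj'.
  have jj : j = j' by apply: (Huniq _ _ f).
  have ee : e = e' by apply: (D_uniq j) => //; rewrite jj.
  have /pred0P/(_ e)/= := Gd i i' ii'; rewrite eG {1}ee eG'.
  by [].
move=> i u v uY vY uv X uX vX.
have [e eG] := uv X uX vX.
have eF : e \in F by apply: (subsetP (GF i)).
case: (boolP (crosses s t X e)) => ceX.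
  case: (boolP (inY e)) => [/andP[sY tY]|nY].
    by rewrite /crosses /= /collapse sY tY addbb.
  by move=> _; exists e; rewrite // inE eF (negbTE nY).
pose y := if s e \in Y then s e else t e.
move=> ceX'.
have [eD yY ayX] : [/\ e \in D, y \in Y & (a \in X) != (y \in X)].
  move: ceX ceX'; rewrite /y /crosses /= /collapse !inE eF /= /crosses.
  by case: (boolP (s e \in Y)) => sY; case: (boolP (t e \in Y)) => tY;
    rewrite ?sY ?tY;
    case: (a \in X); case: (s e \in X); case: (t e \in X).
have [j _ ej] : exists2 j, j \in 'I_(cut s t F Y) & e = c j.
  by move: eD; rewrite -cD => /imsetP[j jk ej]; exists j.
have eHj : e \in H j by rewrite ej.
(* [W] separates [a] from [z] and from the inner end [y] of [e]. The edge of the link through [e]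
   that crosses [W] is therefore not [e]; it lies inside [Y] and crosses [X]. *)
pose W := if a \in X then X :&: Y else Y :\: X.
have aW : a \in W by rewrite /W; case: ifP => aX; rewrite inE aX aY.
have zW : z \notin W by rewrite /W; case: ifP => aX; rewrite inE (negbTE zY) ?andbF.
have yW : y \notin W.
  by move: ayX; rewrite /W; case: ifP => aX; rewrite inE yY; case: (y \in X).
have [f fj cf] := HL j W aW zW.
have fF : f \in F by apply: (subsetP (HF j)).
have WY x : x \in W -> x \in Y.
  by rewrite /W; case: ifP => _; rewrite inE => /andP[].
have fY : inY f.
  rewrite /inY; case: (boolP (crosses s t Y f)) => cfY.
    have fe : f = e by apply: (D_uniq j) => //; rewrite inE fF.
    move: cf cfY yW; rewrite /y -fe /crosses /r /=.
    by case: (boolP (s f \in Y)) => sY; case: (boolP (t f \in Y)) => tY //;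
       rewrite ?(negbTE zW) //= ?addbF ?addFb => ->.
  move: cf cfY; rewrite /crosses /r /=.
  by case: (boolP (s f \in Y)) => sY; case: (boolP (t f \in Y)) => tY //; rewrite (negbTE zW).
exists f.
  rewrite inE fF fY; apply/existsP; exists j; apply/existsP; exists e.
  by rewrite inE eG eD eHj fj.
move: cf; rewrite /crosses /r /=; case/andP: fY => sY tY; rewrite sY tY /W.
by case: ifP => _; rewrite !inE sY tY ?andbT; do 2 case: (_ \in X).
Qed.

End Multigraph.

(** * Packing edge sets that connect the terminals: reduction to edges at terminals *)

Section SteinerPackings.
Variables (V E : finType).
Implicit Types (s t : E -> V) (F G : {set E}) (X Y S : {set V}).

(* For three terminals, every cut separating them isolates one of them. *)
Definition terminal_cuts s t F S (k : nat) : Prop :=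
  forall X, #|X :&: S| = 1 -> k <= cut s t F X.

Definition steiner_packing s t F S (p : nat) : Prop :=
  exists2 G : 'I_p -> {set E}, packing F G &
    forall i, {in S &, forall u v, linked s t (G i) u v}.

Lemma steiner_packing0 s t F S : steiner_packing s t F S 0.
Proof. by exists (fun=> set0); [exact: packing0 | case]. Qed.

Lemma steiner_packing_sub s t F F' S p :
  F \subset F' -> steiner_packing s t F S p -> steiner_packing s t F' S p.
Proof. by move=> FF' [G GF GL]; exists G => //; apply: packing_sub GF. Qed.

(* An edge without end in [S] can be deleted, unless it crosses a tight set,
   which can then be collapsed. *)
Lemma steiner_packing_reduce S k p :
  1 < #|S| ->
  (forall s t F, {in F, forall e, (s e \in S) || (t e \in S)} ->
    terminal_cuts s t F S k -> steiner_packing s t F S p) ->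
  forall s t F, terminal_cuts s t F S k -> steiner_packing s t F S p.
Proof.
move=> S2 base s t F; pose free s t F := [set e in F | (s e \notin S) && (t e \notin S)].
move: {2}#|free s t F| (leqnn #|free s t F|) => n.
elim: n s t F => [|n IHn] s t F Fn cutk.
  apply: base => // e eF; apply: contraLR Fn; rewrite negb_or -ltnNge => eS.
  by rewrite card_gt0; apply/set0Pn; exists e; rewrite inE eF.
have [free0|[e ef]] := set_0Vmem (free s t F).
  by apply: IHn => //; rewrite free0 cards0.
have eF : e \in F by move: ef; rewrite inE => /andP[].
have Fe : #|free s t F :\ e| <= n by move: Fn; rewrite (cardsD1 e) ef.
have [/forallP good|] := boolP [forall X : {set V},
    (#|X :&: S| == 1) ==> (k <= cut s t (F :\ e) X)].
  apply: (@steiner_packing_sub _ _ (F :\ e)); first exact: subsetDl.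
  apply: IHn => [|X XS]; last by have := good X; rewrite XS.
  apply: leq_trans Fe; apply: subset_leq_card; apply/subsetP => g.
  by rewrite !inE => /andP[/andP[-> ->] ->].
rewrite negb_forall => /existsP[Y]; rewrite negb_imply -ltnNge => /andP[YS cY].
(* The set [Y] violated by deleting [e] is crossed by [e] and has cut exactly [k], so it can be
   collapsed to its only terminal [a]. *)
have := cutk Y (eqP YS); rewrite (cutD1 s t Y eF) => cutY.
have ceY : crosses s t Y e by move: cutY cY; case: crosses => //; lia.
have cutYk : cut s t F Y = k by rewrite (cutD1 s t Y eF); move: cutY cY; rewrite ceY; lia.
have /cards1P[a YSa] := YS.
have YSE v : v \in S -> v \in Y -> v = a.
  by move=> vS vY; apply/set1P; rewrite -YSa inE vY.
have [aY aS] : a \in Y /\ a \in S by apply/andP; rewrite -in_setI YSa set11.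
have [z zS za] : exists2 z, z \in S & z != a.
  have : 0 < #|S :\ a| by move: S2; rewrite (cardsD1 a) aS.
  by rewrite card_gt0 => /set0Pn[z]; rewrite !inE => /andP[]; exists z.
have zY : z \notin Y by apply: contra za => zY; rewrite (YSE z).
pose r := collapse Y a.
have rS v : v \in S -> r v = v.
  by move=> vS; rewrite /r /collapse; case: ifP => // /(YSE _ vS).
have rN v : r v \notin S -> r v = v.
  by rewrite /r /collapse; case: ifP => //; rewrite aS.
(* The collapse makes [a] an end of [e], so fewer edges are free of terminals. *)
have [||G GF GL] := IHn (r \o s) (r \o t) F.
- apply: leq_trans Fe; apply: subset_leq_card; apply/subsetP => g.
  rewrite !inE /= => /andP[-> /andP[sg tg]]; have := rN _ sg; have := rN _ tg.
  move=> rt rs; rewrite -{1}rs -{1}rt sg tg !andbT.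
  have nY v : r v \notin S -> v \notin Y.
    by rewrite /r /collapse; case: ifP => //; rewrite aS.
  apply: contraTneq ceY => <-.
  by rewrite /crosses (negbTE (nY _ sg)) (negbTE (nY _ tg)).
- move=> X XS; rewrite cut_collapse; apply: cutk; rewrite -XS.
  apply: eq_card => v; rewrite !inE; case: (boolP (v \in S)) => vS; rewrite ?andbF //.
  by rewrite -/r rS.
have [X aX XY|G' G'F G'L] := @collapse_lift _ _ s t F Y a z p G aY zY _ GF.
- rewrite cutYk; apply: cutk; apply/eqP/cards1P; exists a; apply/setP => v.
  rewrite !inE; apply/andP/eqP => [[vX vS]|->//].
  by apply: YSE => //; apply: (subsetP XY).
by exists G' => // i u v uS vS; apply: G'L; [exact: YSE|exact: YSE|exact: GL].
Qed.

Definition meets (G A : {set E}) : bool := G :&: A != set0.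

Lemma meetsP (G A : {set E}) : reflect (exists2 e, e \in G & e \in A) (meets G A).
Proof.
apply: (iffP (set0Pn _)) => [[e]|[e eG eA]]; last by exists e; rewrite inE eG.
by rewrite inE => /andP[]; exists e.
Qed.

Lemma meetsS (G A A' : {set E}) : A \subset A' -> meets G A -> meets G A'.
Proof. by move=> /subsetP AA' /meetsP[e eG /AA' eA]; apply/meetsP; exists e. Qed.

(** For the bundles of edges between three terminals: [G] contains two sides of the triangle, so it
    connects the terminals. *)
Definition mixed_pair (A B C G : {set E}) : Prop :=
  [\/ meets G A /\ meets G B, meets G A /\ meets G C | meets G B /\ meets G C].

(** Greedy choice: the next set takes one element from each of the two largest classes, and the
    inequalities persist with [p] lowered by one. *)
Lemma three_classes_packing F (A B C : {set E}) p :
  [/\ A \subset F, B \subset F & C \subset F] ->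
  [/\ [disjoint A & B], [disjoint A & C] & [disjoint B & C]] ->
  [/\ p <= #|A| + #|B|, p <= #|A| + #|C| & p <= #|B| + #|C|] ->
  p.*2 <= #|A| + #|B| + #|C| ->
  exists2 G : 'I_p -> {set E}, packing F G & forall i, mixed_pair A B C (G i).
Proof.
elim: p F A B C => [|p IHp] F.
  by move=> A B C _ _ _ _; exists (fun=> set0); [exact: packing0 | case].
have main (A B C : {set E}) : #|C| <= #|A| -> #|C| <= #|B| ->
    [/\ A \subset F, B \subset F & C \subset F] ->
    [/\ [disjoint A & B], [disjoint A & C] & [disjoint B & C]] ->
    [/\ p < #|A| + #|B|, p < #|A| + #|C| & p < #|B| + #|C|] ->
    p.+1.*2 <= #|A| + #|B| + #|C| ->
    exists2 G : 'I_p.+1 -> {set E}, packing F G & forall i, mixed_pair A B C (G i).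
  move=> CA CB [AF BF CF] [AB AC BC] [cAB cAC cBC] cABC.
  have [e eA] : exists e, e \in A.
    by apply/set0Pn; rewrite -card_gt0; move: CA cAC; clear; lia.
  have [f fB] : exists f, f \in B.
    by apply/set0Pn; rewrite -card_gt0; move: CB cBC; clear; lia.
  have disjN (X Y : {set E}) g : [disjoint X & Y] -> g \in X -> g \notin Y.
    by rewrite disjoint_subset => /subsetP XY /XY.
  have [eB eC] : e \notin B /\ e \notin C by split; [apply: disjN AB _|apply: disjN AC _].
  have [fA fC] : f \notin A /\ f \notin C.
    by split; [apply: (disjN B) => //; rewrite disjoint_sym|apply: disjN BC _].
  have [||||G GF GM] := IHp (F :\: [set e; f]) (A :\ e) (B :\ f) C.
  - split; apply/subsetP => g.
    + rewrite !inE negb_or => /andP[-> gA]; rewrite (subsetP AF) // andbT /=.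
      by apply: contraNneq fA => <-.
    + rewrite !inE negb_or => /andP[-> gB]; rewrite (subsetP BF) // !andbT /=.
      by apply: contraNneq eB => <-.
    + rewrite !inE negb_or => gC; rewrite (subsetP CF) // !andbT /=.
      by apply/andP; split; [apply: contraNneq eC => <-|apply: contraNneq fC => <-].
  - by split; [apply: disjointW AB|apply: disjointWl AC|apply: disjointWl BC]; rewrite subsetDl.
  - move: CA CB cAB cAC cBC cABC; rewrite (cardsD1 e A) (cardsD1 f B) eA fB.
    by clear; split; lia.
  - move: cABC; rewrite (cardsD1 e A) (cardsD1 f B) eA fB; clear; lia.
  exists (fun i : 'I_p.+1 => if unlift ord0 i is Some j then G j else [set e; f]).
    have -> : F = [set e; f] :|: F :\: [set e; f].
      apply/setP => g; rewrite !inE; case: eqP => [->|_] /=; first by rewrite (subsetP AF).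
      by case: eqP => [->|_] //=; rewrite (subsetP BF).
    by apply: packing_cons => //; rewrite disjoint_sym disjoints_subset subsetC subsetDr
      || rewrite -setI_eq0 setIDA setDIl setDv set0I.
  move=> i; case: unliftP => [j _|_].
    have A' : A :\ e \subset A by apply: subsetDl.
    have B' : B :\ f \subset B by apply: subsetDl.
    case: (GM j) => -[m1 m2].
    + by apply: Or31; split; [apply: meetsS A' m1|apply: meetsS B' m2].
    + by apply: Or32; split; [apply: meetsS A' m1|].
    + by apply: Or33; split; [apply: meetsS B' m1|].
  by apply: Or31; split; apply/meetsP; [exists e|exists f]; rewrite // !inE eqxx ?orbT.
move=> A B C [AF BF CF] [AB AC BC] [cAB cAC cBC] cABC.
have [BA CA CB] : [/\ [disjoint B & A], [disjoint C & A] & [disjoint C & B]].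
  by split; rewrite disjoint_sym.
have [c1|c1] := leqP #|C| #|A|; have [c2|c2] := leqP #|C| #|B|; first exact: main.
- have [|||||//|G GF GM] := main A C B; try (by []); try (by move: c1 c2; clear; lia).
  + by split=> //; move: cBC; clear; lia.
  + by move: cABC; clear; lia.
  exists G => // i; case: (GM i) => -[m1 m2]; [exact: Or32|exact: Or31|exact: Or33].
- have [|||||//|G GF GM] := main C B A; try (by []); try (by move: c1 c2; clear; lia).
  + by split=> //; move: cAB cAC cBC; clear; lia.
  + by move: cABC; clear; lia.
  exists G => // i; case: (GM i) => -[m1 m2]; [exact: Or33|exact: Or32|exact: Or31].
have [BA'|AB'] := leqP #|B| #|A|.
  have [|||||//|G GF GM] := main A C B; try (by []); try (by move: c1 c2 BA'; clear; lia).
  + by split=> //; move: cBC; clear; lia.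
  + by move: cABC; clear; lia.
  exists G => // i; case: (GM i) => -[m1 m2]; [exact: Or32|exact: Or31|exact: Or33].
have [|||||//|G GF GM] := main C B A; try (by []); try (by move: c1 c2 AB'; clear; lia).
+ by split=> //; move: cAB cAC cBC; clear; lia.
+ by move: cABC; clear; lia.
exists G => // i; case: (GM i) => -[m1 m2]; [exact: Or33|exact: Or32|exact: Or31].
Qed.

Definition joins s t (v w : V) (e : E) : bool :=
  ((s e == v) && (t e == w)) || ((s e == w) && (t e == v)).

Definition bundle s t F (v w : V) : {set E} := [set e in F | joins s t v w e].

Lemma bundleE s t F v w : #|bundle s t F v w| = \sum_(e in F) joins s t v w e.
Proof.
rewrite -sum1_card big_mkcond [RHS]big_mkcond; apply: eq_bigr => e _.
by rewrite inE; case: (e \in F); case: joins.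
Qed.

Lemma linked_joins s t F v w e : e \in F -> joins s t v w e -> linked s t F v w.
Proof.
move=> eF /orP[] /andP[/eqP <- /eqP <-]; first exact: linked_edge.
exact/linked_sym/linked_edge.
Qed.

Lemma crosses_joins s t X v w e :
  joins s t v w e -> crosses s t X e = (v \in X) (+) (w \in X).
Proof. by case/orP=> /andP[/eqP sv /eqP tw]; rewrite /crosses sv tw // addbC. Qed.

(** Every edge has an end in [S], so the edges at [v] run to [x], [y] or [z]; moving [v] into [X]
    loses those to [x] and gains the others. *)
Lemma cut_move s t F S X (v x y z : V) :
  S = [set x; y; z] -> v \notin S -> y != z ->
  {in F, forall e, (s e \in S) || (t e \in S)} ->
  v \notin X -> x \in X -> y \notin X -> z \notin X ->
  cut s t F (v |: X) + #|bundle s t F v x| =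
  cut s t F X + #|bundle s t F v y| + #|bundle s t F v z|.
Proof.
move=> SE vS yz FS vX xX yX zX; rewrite !bundleE /cut -!big_split /=.
apply: eq_bigr => e /FS; rewrite SE !inE => eS.
have [vx vy vz] : [/\ v != x, v != y & v != z].
  by move: vS; rewrite SE !inE !negb_or => /andP[/andP[]].
have [xy xz] : x != y /\ x != z.
  by split; [apply: contraNneq yX => <-|apply: contraNneq zX => <-].
have N := (negbTE vx, negbTE vy, negbTE vz, negbTE xy, negbTE xz, negbTE yz).
have M := (eq_sym x v, eq_sym y v, eq_sym z v, eq_sym y x, eq_sym z x, eq_sym z y).
rewrite /crosses /joins !inE.
have [sv|sv] := eqVneq (s e) v.
  by move: eS; rewrite sv !N /= => /orP[/orP[]|] /eqP ->;
    rewrite ?eqxx ?M ?N ?(negbTE vX) ?xX ?(negbTE yX) ?(negbTE zX).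
have [tv|tv] := eqVneq (t e) v.
  by move: eS; rewrite tv !N /= orbF => /orP[/orP[]|] /eqP ->;
    rewrite ?eqxx ?M ?N ?(negbTE vX) ?xX ?(negbTE yX) ?(negbTE zX).
by rewrite /= !andbF !addn0.
Qed.

End SteinerPackings.

(** * Effect on terminal cuts of deleting, splitting off and removing a star *)

Section TripleReductions.
Variables (V E : finType).
Implicit Types (s t : E -> V) (F G : {set E}) (X Y S : {set V}).

Definition triple S (x y z : V) : Prop := S = [set x; y; z] /\ uniq [:: x; y; z].

Lemma triple_swap S x y z : triple S x y z -> triple S y x z.
Proof.
move=> [-> xyz]; split; first by rewrite (setUC [set x]).
by move: xyz; rewrite /= !inE !negb_or (eq_sym y x) => /and3P[/andP[-> ->] -> _].
Qed.

Lemma triple_rot S x y z : triple S x y z -> triple S z x y.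
Proof.
move=> [-> xyz]; split; first by rewrite setUC setUA.
by move: xyz; rewrite /= !inE !negb_or !(eq_sym z) => /and3P[/andP[-> ->] -> _].
Qed.

Lemma triple_in S x y z : triple S x y z -> [/\ x \in S, y \in S & z \in S].
Proof. by case=> -> _; rewrite !inE !eqxx !orbT. Qed.

Definition lone X (x y z : V) : bool := [&& x \in X, y \notin X & z \notin X].

Lemma loneP S X x y z : triple S x y z ->
  #|X :&: S| = 1 -> [\/ lone X x y z, lone X y x z | lone X z x y].
Proof.
move=> [-> ]; rewrite /= !inE !negb_or => /and3P[/andP[xy xz] yz _] /eqP/cards1P[w XSw].
have XE v : v \in [set x; y; z] -> (v \in X) = (v == w).
  by move=> vS; rewrite -[RHS]in_set1 -XSw inE vS andbT.
have : w \in X :&: [set x; y; z] by rewrite XSw set11.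
rewrite !inE => /andP[_ wS]; rewrite /lone !XE ?inE ?eqxx ?orbT //.
case/orP: wS => [/orP[]|] /eqP ->.
- by apply: Or31; rewrite eqxx !(eq_sym _ x) xy xz.
- by apply: Or32; rewrite eqxx xy (eq_sym z) yz.
- by apply: Or33; rewrite eqxx xz yz.
Qed.

Lemma lone_card S X x y z : triple S x y z -> lone X x y z -> #|X :&: S| = 1.
Proof.
move=> [-> xyz] /and3P[xX yX zX]; apply/eqP/cards1P; exists x; apply/setP => v.
rewrite !inE; case: (eqVneq v x) => [->|vx] /=; first by rewrite xX.
by case: eqP => [->|_]; [rewrite (negbTE yX)|case: eqP => [->|_]; rewrite ?(negbTE zX) ?andbF].
Qed.

Definition touching s t F S : Prop := {in F, forall e, (s e \in S) || (t e \in S)}.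

Lemma joins_inj s t (v x y : V) e :
  v != x -> joins s t v x e -> joins s t v y e -> x = y.
Proof.
rewrite /joins eq_sym => vx /orP[] /andP[/eqP -> /eqP ->];
  by rewrite eqxx (negbTE vx) ?andbT /= ?andbF ?orbF => /eqP.
Qed.

Section Reduction.
Variables (s t : E -> V) (F : {set E}) (S : {set V}) (k : nat) (v : V).
Hypotheses (vS : v \notin S) (FS : touching s t F S) (cutk : terminal_cuts s t F S k).

Let d w := #|bundle s t F v w|.

(* Moving [v] across [X] changes the cut by the edges from [v] to [x], [y], [z],
   and the moved cut still has size at least [k]. *)
Lemma lone_slack X x y z : triple S x y z -> lone X x y z ->
  (v \in X -> k + d y + d z <= cut s t F X + d x) /\
  (v \notin X -> k + d x <= cut s t F X + d y + d z).
Proof.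
move=> T LX; have /and3P[xX yX zX] := LX.
have [SE xyz] := T.
have yz : y != z by move: xyz; rewrite /= !inE => /and3P[].
have xv : v != x by apply: contraNneq vS => ->; have [] := triple_in T.
have yv : v != y by apply: contraNneq vS => ->; have [] := triple_in T.
have zv : v != z by apply: contraNneq vS => ->; have [] := triple_in T.
split=> vX.
  have Xv : v |: X :\ v = X by apply: setD1K.
  have LXv : lone (X :\ v) x y z.
    by rewrite /lone !inE xX (negbTE yX) (negbTE zX) !andbF (eq_sym x) xv.
  have vXv : v \notin X :\ v by rewrite !inE eqxx.
  have /and3P[xXv yXv zXv] := LXv.
  have := cut_move SE vS yz FS vXv xXv yXv zXv; rewrite Xv -/(d x) -/(d y) -/(d z) => ->.
  by rewrite -!addnA leq_add2r; apply: cutk; apply: lone_card LXv.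
rewrite -(cut_move SE vS yz FS vX xX yX zX) -/(d x) leq_add2r.
apply: cutk; apply: (lone_card T); rewrite /lone !inE xX (negbTE yX) (negbTE zX) orbT.
by rewrite !(eq_sym _ v) (negbTE yv) (negbTE zv).
Qed.

(** If [e] crosses [X], then [v] and [x] lie on different sides, and [lone_slack] with the strict
    inequality on [d x] gives a cut larger than [k]. *)
Lemma delete_terminal_cuts x y z e : triple S x y z ->
  d y + d z < d x -> e \in F -> joins s t v x e -> terminal_cuts s t (F :\ e) S k.
Proof.
move=> T dx eF evx X X1; have := cutk X1.
rewrite (cutD1 s t X eF) (crosses_joins X evx).
have := loneP T X1; have T2 := triple_swap T; have T3 := triple_rot T.
case: (boolP (v \in X)) => vX; case: (boolP (x \in X)) => xX //= [] L.
- by move: L; rewrite /lone (negbTE xX).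
- have [/(_ vX) + _] := lone_slack T2 L; rewrite (cutD1 s t X eF) (crosses_joins X evx).
  by rewrite vX (negbTE xX) /=; move: dx; clear; lia.
- have [/(_ vX) + _] := lone_slack T3 L; rewrite (cutD1 s t X eF) (crosses_joins X evx).
  by rewrite vX (negbTE xX) /=; move: dx; clear; lia.
- have [_ /(_ vX)] := lone_slack T L; rewrite (cutD1 s t X eF) (crosses_joins X evx).
  by rewrite xX (negbTE vX) /=; move: dx; clear; lia.
- by move: L; rewrite /lone xX andbF.
- by move: L; rewrite /lone xX andbF.
Qed.

(** A terminal cut shrinks, by two, only if [X] contains [v] and [z] but neither [x] nor [y]; there
    [lone_slack] provides the surplus [d x + d y - d z], at least 2. *)
Lemma split_terminal_cuts x y z e f s1 t1 t2 : triple S x y z ->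
  d z + 2 <= d x + d y -> e \in F -> f \in F -> joins s t v x e -> joins s t v y f ->
  (forall X g, crosses s1 t1 X g = crosses s t X g) ->
  (forall g, g != e -> t2 g = t1 g) -> s1 e = x -> t2 e = y ->
  terminal_cuts s1 t2 (F :\ f) S k.
Proof.
move=> T dz eF fF evx fvy cE t2E s1e t2e X X1.
have [SE xyz] := T; have [xS yS zS] := triple_in T.
have xy : x != y by move: xyz; rewrite /= !inE negb_or => /and3P[/andP[]].
have vx : v != x by apply: contraNneq vS => ->.
have vy : v != y by apply: contraNneq vS => ->.
have fe : f != e.
  by apply: contraNneq xy => fe; apply/eqP; apply: (joins_inj vx evx); rewrite -fe.
have eFf : e \in F :\ f by rewrite !inE eq_sym fe.
have rest : cut s1 t2 (F :\ f :\ e) X = cut s t (F :\ f :\ e) X.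
  apply: eq_bigr => g; rewrite !inE => /andP[ge _].
  by rewrite -cE /crosses t2E.
have cutFX : cut s t F X = ((v \in X) (+) (y \in X)) + ((v \in X) (+) (x \in X) +
    cut s t (F :\ f :\ e) X).
  by rewrite (cutD1 s t X fF) (cutD1 s t X eFf) (crosses_joins X evx) (crosses_joins X fvy).
rewrite (cutD1 s1 t2 X eFf) rest /crosses s1e t2e.
have := cutk X1; rewrite cutFX.
have T2 := triple_swap T; have T3 := triple_rot T.
case: (loneP T X1) => L; have /and3P[X1' X2' X3'] := L.
- by rewrite X1' (negbTE X2') /=; case: (v \in X); clear; lia.
- by rewrite X1' (negbTE X2') /=; case: (v \in X); clear; lia.
- have [/= + _] := lone_slack T3 L; rewrite cutFX (negbTE X2') (negbTE X3') /=.
  by case: (v \in X) => [/(_ isT)|_] /=; move: dz; clear; lia.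
Qed.

(** A cut isolating a terminal loses one edge of the star if [v] is outside [X]. If [v] is inside it
    loses two, but then [lone_slack] gives a cut of size at least [k + 1]. *)
Lemma star_terminal_cuts x y z e f g : triple S x y z ->
  d x = 1 -> d y = 1 -> d z = 1 ->
  e \in F -> f \in F :\ e -> g \in F :\ e :\ f ->
  joins s t v x e -> joins s t v y f -> joins s t v z g ->
  terminal_cuts s t (F :\ e :\ f :\ g) S k.-1.
Proof.
move=> T dx dy dz eF fF gF evx fvy gvz X X1.
have cutFX : cut s t F X = ((v \in X) (+) (x \in X)) + (((v \in X) (+) (y \in X)) +
   ((v \in X) (+) (z \in X) + cut s t (F :\ e :\ f :\ g) X)).
  by rewrite (cutD1 s t X eF) (cutD1 s t X fF) (cutD1 s t X gF) (crosses_joins X evx)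
     (crosses_joins X fvy) (crosses_joins X gvz).
have T2 := triple_swap T; have T3 := triple_rot T; have := cutk X1; rewrite cutFX.
case: (loneP T X1) => L; have /and3P[X1' X2' X3'] := L.
- have [+ _] := lone_slack T L; rewrite cutFX dx dy dz X1' (negbTE X2') (negbTE X3') /=.
  by case: (v \in X) => [/(_ isT)|_] /=; clear; lia.
- have [+ _] := lone_slack T2 L; rewrite cutFX dx dy dz X1' (negbTE X2') (negbTE X3') /=.
  by case: (v \in X) => [/(_ isT)|_] /=; clear; lia.
- have [+ _] := lone_slack T3 L; rewrite cutFX dx dy dz X1' (negbTE X2') (negbTE X3') /=.
  by case: (v \in X) => [/(_ isT)|_] /=; clear; lia.
Qed.

End Reduction.
End TripleReductions.

(** * Three terminals: [k - 1] disjoint connecting sets when [k] is at most 5 *)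

Section TriplePackings.
Variables (V E : finType).
Implicit Types (s t : E -> V) (F G : {set E}) (X Y S : {set V}).

Lemma linked_triple s t G S (w x y z : V) : triple S x y z ->
  linked s t G w x -> linked s t G w y -> linked s t G w z ->
  {in S &, forall u v, linked s t G u v}.
Proof.
move=> [-> _] wx wy wz; suff wS u : u \in [set x; y; z] -> linked s t G w u.
  by move=> u v /wS wu /wS wv; apply: linked_trans wv; apply: linked_sym.
by rewrite !inE => /orP[/orP[]|] /eqP ->.
Qed.

Lemma inner_free_packing S (a b c : V) s t F k : triple S a b c -> k <= 5 ->
  {in F, forall e, (s e \in S) && (t e \in S)} -> terminal_cuts s t F S k ->
  steiner_packing s t F S k.-1.
Proof.
move=> T k5 FS cutk; have T2 := triple_swap T; have T3 := triple_rot T.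
have neq x y z : triple S x y z -> [/\ x != y, x != z & y != z].
  by move=> [_]; rewrite /= !inE negb_or => /and3P[/andP[]].
have joinsC v w e : joins s t v w e = joins s t w v e by rewrite /joins orbC.
have bundleC v w : bundle s t F v w = bundle s t F w v.
  by apply/setP => e; rewrite !inE joinsC.
have cutx x y z : triple S x y z -> k <= #|bundle s t F x y| + #|bundle s t F x z|.
  move=> Tx; have [xy xz yz] := neq _ _ _ Tx.
  have Lx : lone [set x] x y z by rewrite /lone !inE eqxx !(eq_sym _ x) xy xz.
  apply: leq_trans (cutk _ (lone_card Tx Lx)) _.
  rewrite !bundleE -big_split /=; apply: leq_sum => e /FS.
  have [-> _] := Tx; rewrite !inE /crosses /joins !inE.
  by case: (eqVneq (s e) x) => [->|_] /=; case: (eqVneq (t e) x) => [->|_] //=;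
    rewrite ?(negbTE xy) ?(negbTE xz) ?andbT ?andbF ?orbF //= => /orP[] ->; lia.
have disj x y z : triple S x y z -> [disjoint bundle s t F x y & bundle s t F x z].
  move=> Tx; have [xy xz yz] := neq _ _ _ Tx; rewrite -setI_eq0; apply/eqP/setP => e.
  rewrite !inE; apply/negbTE; apply/negP => /andP[/andP[_ e1] /andP[_ e2]].
  by have /eqP := joins_inj xy e1 e2; apply/negP.
have [||||G GF GM] := @three_classes_packing E F
    (bundle s t F a b) (bundle s t F a c) (bundle s t F b c) k.-1.
- by split; apply/subsetP => e; rewrite inE => /andP[].
- split; first exact: disj T.
  + by rewrite bundleC; apply: disj T2.
  + by rewrite (bundleC a) (bundleC b); apply: disj T3.
- have := cutx _ _ _ T; have := cutx _ _ _ T2; have := cutx _ _ _ T3.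
  by rewrite (bundleC b a) (bundleC c a) (bundleC c b); clear; split; lia.
(* The cuts give twice the number of edges at least [3 k]; after rounding up, the number of edges is
   at least [2 (k - 1)] exactly because [k <= 5]. *)
- have := cutx _ _ _ T; have := cutx _ _ _ T2; have := cutx _ _ _ T3.
  by rewrite (bundleC b a) (bundleC c a) (bundleC c b); move: k5; clear; lia.
have GL i v w : meets (G i) (bundle s t F v w) -> linked s t (G i) v w.
  move=> /meetsP[e eG]; rewrite inE => /andP[_]; exact: linked_joins.
exists G => // i; case: (GM i) => -[/GL m1 /GL m2].
- exact: (linked_triple T (@linked_refl _ _ _ _ _ _) m1 m2).
- exact: (linked_triple T (linked_sym m1) (@linked_refl _ _ _ _ _ _) m2).
- exact: (linked_triple T (linked_sym m1) (linked_sym m2) (@linked_refl _ _ _ _ _ _)).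
Qed.

(* When all edges meet the terminals, an inner vertex with [d x], [d y], [d z]
   edges to them either has a superfluous edge, or admits splitting off a pair of
   edges to distinct terminals, or is the centre of a star with three edges. *)
Lemma touching_packing S (a b c : V) s t F k : triple S a b c -> k <= 5 ->
  touching s t F S -> terminal_cuts s t F S k -> steiner_packing s t F S k.-1.
Proof.
move=> T; have T2 := triple_swap T; have T3 := triple_rot T.
move: {2}#|F| (leqnn #|F|) => n; elim: n s t F k => [|n IHn] s t F k Fn k5 FS cutk.
  apply: (inner_free_packing T) => // e eF.
  by move: Fn; rewrite leqn0 cards_eq0 => /eqP F0; rewrite F0 inE in eF.
have FD e : e \in F -> #|F :\ e| <= n by move=> eF; move: Fn; rewrite (cardsD1 e) eF.
have FDS (D : {set E}) : touching s t (F :\: D) S.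
  by move=> e; rewrite inE => /andP[_ /FS].
have [inner|] := boolP [forall e in F, (s e \in S) && (t e \in S)].
  by apply: (inner_free_packing T) => // e eF; move/forall_inP: inner => ->.
rewrite negb_forall_in => /exists_inP[e0 e0F e0S].
have [v [vS e0v]] : exists v, v \notin S /\
    [\/ joins s t v a e0, joins s t v b e0 | joins s t v c e0].
  have := FS _ e0F; rewrite negb_and in e0S.
  have SE : S = [set a; b; c] by case: T.
  case/orP: e0S => nS; [exists (s e0)|exists (t e0)]; split=> //;
    rewrite /joins !eqxx /= ?andbT; have := FS _ e0F; rewrite (negbTE nS) ?orbF /= SE !inE.
    by case/orP=> [/orP[]|] ->; [apply: Or31|apply: Or32|apply: Or33].
  by case/orP=> [/orP[]|] ->; rewrite orbT; [apply: Or31|apply: Or32|apply: Or33].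
pose d w := #|bundle s t F v w|.
have bd w : 0 < d w -> exists2 e, e \in F & joins s t v w e.
  by rewrite card_gt0 => /set0Pn[e]; rewrite inE => /andP[]; exists e.
have delete x y z : triple S x y z -> d y + d z < d x -> steiner_packing s t F S k.-1.
  move=> Tx dx; have [e eF ev] := bd x (leq_ltn_trans (leq0n _) dx).
  apply: (@steiner_packing_sub _ _ _ _ (F :\ e)); first exact: subsetDl.
  apply: IHn => //; [exact: FD|exact: delete_terminal_cuts Tx dx eF ev].
have split x y z : triple S x y z -> d z + 2 <= d x + d y -> 0 < d x -> 0 < d y ->
    steiner_packing s t F S k.-1.
  move=> Tx dz /bd[e eF ev] /bd[f fF fv].
  have [xS yS zS] := triple_in Tx.
  have vx : v != x by apply: contraNneq vS => ->.
  have xy : x != y by case: Tx => _; rewrite /= !inE negb_or => /and3P[/andP[]].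
  have fe : f != e.
    by apply: contraNneq xy => fe; apply/eqP; apply: (joins_inj vx ev); rewrite -fe.
  (* The two edges are first turned into arcs from [x] to [v] and from [v] to [y], the form required
     for splitting off. *)
  pose s1 g := if g == e then x else if g == f then v else s g.
  pose t1 g := if g == e then v else if g == f then y else t g.
  have cE X g : crosses s1 t1 X g = crosses s t X g.
    rewrite /crosses /s1 /t1; case: (eqVneq g e) => [->|_].
      by rewrite addbC -(crosses_joins X ev).
    by case: (eqVneq g f) => [->|_] //; rewrite -(crosses_joins X fv).
  pose t2 g := if g == e then t1 f else t1 g.
  have [||||G GF GL] := IHn s1 t2 (F :\ f) k; rewrite ?FD //.
  - move=> g; rewrite !inE /t2 /s1 /t1 => /andP[gf gF].
    case: (eqVneq g e) => [_|_]; first by rewrite xS.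
    by rewrite (negbTE gf); apply: FS.
  - apply: (split_terminal_cuts vS FS cutk Tx dz eF fF ev fv cE) => [g ge||].
    + by rewrite /t2 (negbTE ge).
    + by rewrite /s1 eqxx.
    + by rewrite /t2 eqxx /t1 (negbTE fe) eqxx.
  exists (fun i => if e \in G i then f |: G i else G i).
    exact: packing_split.
  move=> i u w uS wS; apply: (linked_crosses cE); apply: linked_split; last exact: GL.
  by rewrite /t1 /s1 eqxx (negbTE fe) eqxx.
have star : d a = 1 -> d b = 1 -> d c = 1 -> steiner_packing s t F S k.-1.
  move=> da db dc; have [|e eF ev] := bd a; first by rewrite da.
  have [|f fF fv] := bd b; first by rewrite db.
  have [|g gF gv] := bd c; first by rewrite dc.
  have [[aS bS cS] [SE abc]] := (triple_in T, T).
  have va : v != a by apply: contraNneq vS => ->.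
  have vb : v != b by apply: contraNneq vS => ->.
  have [ab ac bc] : [/\ a != b, a != c & b != c].
    by move: abc; rewrite /= !inE negb_or => /and3P[/andP[]].
  have neq x y h h' : v != x -> joins s t v x h -> joins s t v y h' -> x != y -> h' != h.
    move=> vx hv h'v; apply: contraNneq => hh.
    by apply/eqP; apply: (joins_inj vx hv); rewrite -hh.
  have fF' : f \in F :\ e by rewrite !inE fF (neq a b e f).
  have gF' : g \in F :\ e :\ f by rewrite !inE gF (neq b c f g) // (neq a c e g).
  case: (leqP k 1) => k1.
    have -> : k.-1 = 0 by move: k1; clear; lia.
    exact: steiner_packing0.
  (* Without the star the terminal cuts are at least [k - 1], which yields [k - 2] sets; the star is
     the missing one. *)
  have [||||G GF GL] := IHn s t (F :\ e :\ f :\ g) k.-1.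
  - by apply: leq_trans (FD _ eF); apply: subset_leq_card; apply/subsetP => h;
      rewrite !inE => /and4P[_ _ -> ->].
  - by apply: leq_trans (leq_pred _) k5.
  - by move=> h; rewrite !inE => /and4P[_ _ _ /FS].
  - exact: (star_terminal_cuts vS FS cutk T da db dc).
  have kE : k.-1 = k.-2.+1 by move: k1; clear; lia.
  rewrite kE.
  exists (fun i : 'I_k.-2.+1 => if unlift ord0 i is Some j then G j else [set e; f; g]).
    have -> : F = [set e; f; g] :|: F :\ e :\ f :\ g.
      apply/setP => h; rewrite !inE; case: (eqVneq h e) => [->|_]; rewrite ?eF //=.
      by case: (eqVneq h f) => [->|_]; rewrite ?fF //=; case: (eqVneq h g) => [->|_]; rewrite ?gF.
    apply: packing_cons => //; rewrite disjoint_sym disjoints_subset.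
    by apply/subsetP => h; rewrite !inE => /orP[/orP[]|] /eqP ->; rewrite eqxx ?andbF.
  move=> i; case: unliftP => [j _|_]; first exact: GL.
  apply: (linked_triple T (w := v)).
  - by apply: linked_joins ev; rewrite !inE eqxx.
  - by apply: linked_joins fv; rewrite !inE eqxx orbT.
  - by apply: linked_joins gv; rewrite !inE eqxx orbT.
have dpos : 0 < d a + d b + d c.
  have dp x : joins s t v x e0 -> 0 < d x.
    by move=> e0x; rewrite card_gt0; apply/set0Pn; exists e0; rewrite inE e0F.
  by case: e0v => /dp; case: (d a) (d b) (d c) => [|?] [|?] [|?].
have dab := delete _ _ _ T; have dba := delete _ _ _ T2; have dca := delete _ _ _ T3.
have sab := split _ _ _ T; have sca := split _ _ _ T3.
have sbc := split _ _ _ (triple_rot T3).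
(* When no deletion applies, [d] satisfies the triangle inequalities; these make both multiplicities
   positive in each splitting case. *)
have [/dab//|a_le] := ltnP (d b + d c) (d a).
have [/dba//|b_le] := ltnP (d a + d c) (d b).
have [/dca//|c_le] := ltnP (d a + d b) (d c).
have [h|c_ge] := leqP (d c + 2) (d a + d b).
  by apply: sab => //; move: h a_le b_le; clear; lia.
have [h|b_ge] := leqP (d b + 2) (d c + d a).
  by apply: sca => //; move: h a_le c_le; clear; lia.
have [h|a_ge] := leqP (d a + 2) (d b + d c).
  by apply: sbc => //; move: h b_le c_le; clear; lia.
(* If no pair can be split off, adding two of the inequalities such as [d a + d b <= d c + 1] bounds
   each multiplicity by 1; the triangle inequalities and [dpos] leave only three ones. *)
by apply: star; move: dpos a_le b_le c_le a_ge b_ge c_ge; clear; lia.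
Qed.

Lemma three_terminal_packing S s t F k : #|S| = 3 -> k <= 5 ->
  terminal_cuts s t F S k -> steiner_packing s t F S k.-1.
Proof.
move=> S3 k5; apply: steiner_packing_reduce; first by rewrite S3.
move=> {}s {}t {}F FS cutk.
have [a aS] : exists a, a \in S by apply/set0Pn; rewrite -card_gt0 S3.
have : #|S :\ a| = 2 by move: S3; rewrite (cardsD1 a) aS => -[].
move=> /eqP/cards2P[b [c [bc Sa]]].
apply: (@touching_packing S a b c) => //; split.
  by rewrite -setUA -Sa setD1K.
have /negbTE : a \notin S :\ a by rewrite !inE eqxx.
by rewrite Sa /= !inE => ->; rewrite bc.
Qed.

End TriplePackings.

(** * K5 minors in graphs of minimum degree at least 6 *)

Section CompleteMinor.
Variables (V : finType) (adj : rel V).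
Hypothesis adj_sym : symmetric adj.
Implicit Types (X Y Z : {set V}) (B : {set {set V}}).

Definition adj_within X : rel V := fun u v => [&& adj u v, u \in X & v \in X].

Definition branch X : bool :=
  (X != set0) && [forall u in X, forall v in X, connect (adj_within X) u v].

Definition touch X Y : bool := [exists x in X, exists y in Y, adj x y].

Lemma touchP X Y : reflect (exists x y, [/\ x \in X, y \in Y & adj x y]) (touch X Y).
Proof.
apply: (iffP exists_inP) => [[x xX /exists_inP[y yY xy]]|[x [y [xX yY xy]]]].
  by exists x, y.
by exists x => //; apply/exists_inP; exists y.
Qed.

Lemma touchC X Y : touch X Y = touch Y X.
Proof.
by apply/touchP/touchP => -[x [y [xX yY xy]]]; exists y, x; rewrite adj_sym.
Qed.

Lemma touchUl X Y Z : touch (X :|: Y) Z = touch X Z || touch Y Z.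
Proof.
apply/touchP/orP => [[x [z [xXY zZ xz]]]|[] /touchP[x [z [xX zZ xz]]]].
- move: xXY; rewrite inE => /orP[xX|xY]; [left|right]; apply/touchP; exists x, z;
    by split.
- by exists x, z; rewrite inE xX.
- by exists x, z; rewrite inE xX orbT.
Qed.

Lemma adj_within_sym X : connect_sym (adj_within X).
Proof.
by apply: sym_connect_sym => u v; rewrite /adj_within adj_sym andbCA andbC andbA.
Qed.

Lemma branchU X Y : branch X -> branch Y -> touch X Y -> branch (X :|: Y).
Proof.
move=> /andP[X0 /forall_inP cX] /andP[Y0 /forall_inP cY] /touchP[x [y [xX yY xy]]].
have mono Z Z' : Z \subset Z' -> subrel (connect (adj_within Z)) (connect (adj_within Z')).
  move=> /subsetP ZZ'; apply: connect_sub => u v /and3P[uv uZ vZ].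
  by apply: connect1; rewrite /adj_within uv !ZZ'.
have toy u : u \in X :|: Y -> connect (adj_within (X :|: Y)) u y.
  rewrite inE => /orP[uX|uY].
    apply: (connect_trans (y := x)).
      apply: (mono X); first exact: subsetUl.
      by have /forall_inP := cX _ uX; apply.
    by apply: connect1; rewrite /adj_within xy !inE xX yY orbT.
  apply: (mono Y); first exact: subsetUr.
  by have /forall_inP := cY _ uY; apply.
apply/andP; split.
  by apply/set0Pn; exists x; rewrite inE xX.
apply/forall_inP => u uXY; apply/forall_inP => v vXY.
by apply: connect_trans (toy _ uXY) _; rewrite adj_within_sym; apply: toy.
Qed.

Lemma branch1 v : branch [set v].
Proof.
apply/andP; split; first by apply/set0Pn; exists v; rewrite inE.
apply/forall_inP => x; rewrite inE => /eqP ->.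
by apply/forall_inP => y; rewrite inE => /eqP ->.
Qed.

(** A family [B] of branch sets stands for the minor whose vertices are its members, adjacent when
    they touch; only vertex deletions and contractions occur. *)
Definition nb B X : {set {set V}} := [set Y in B | (Y != X) && touch X Y].

Definition degsum B : nat := \sum_(X in B) #|nb B X|.

Lemma nb_self B X : nb (X |: B) X = nb B X.
Proof.
by apply/setP => Y; rewrite !inE; case: eqP => //=; rewrite andbF.
Qed.

Lemma degsumU1 B Z : Z \notin B -> degsum (Z |: B) = degsum B + #|nb B Z|.*2.
Proof.
move=> ZB; rewrite /degsum big_setU1 //= nb_self addnC -addnn addnA; congr (_ + _).
rewrite -[in RHS]sum1_card [X in _ + X]big_mkcond [in X in _ + X](bigID (mem B)) /=.
rewrite [X in _ + (_ + X)]big1 ?addn0; last first.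
  by move=> Y YB; rewrite !inE (negbTE YB).
rewrite -big_split /=; apply: eq_bigr => X XB.
have XZ : X != Z by apply: contraNneq ZB => <-.
rewrite !inE XB XZ (touchC Z X) /=; case: ifP => XtZ.
  have -> : nb (Z |: B) X = Z |: nb B X.
    by apply/setP => Y; rewrite !inE; case: eqP => [->|] //=; rewrite eq_sym XZ XtZ.
  by rewrite cardsU1 !inE (negbTE ZB) addnC.
rewrite addn0; apply: eq_card => Y; rewrite !inE; case: eqP => [->|] //=.
by rewrite XtZ andbF (negbTE ZB).
Qed.

Definition branch_family B : bool := trivIset B && [forall X in B, branch X].

(* Mader's bound [m >= 3 n - 5], as [degsum B] is twice the number of edges. *)
Definition dense B : bool := (2 < #|B|) && (6 * #|B| <= degsum B + 10).

Definition K5_model (s : seq {set V}) : bool :=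
  [&& size s == 5, all branch s & pairwise (fun X Y => [disjoint X & Y] && touch X Y) s].

Section MinimalFamily.
Variable B : {set {set V}}.
Hypothesis Bfam : branch_family B.
Hypothesis Bdense : dense B.
Hypothesis Bmin : forall B', branch_family B' -> dense B' -> #|B| <= #|B'|.

Let n := #|B|.

Lemma branchB X : X \in B -> branch X.
Proof. by move=> XB; have /andP[_ /forall_inP] := Bfam; apply. Qed.

Lemma disjB X Y : X \in B -> Y \in B -> X != Y -> [disjoint X & Y].
Proof. by have /andP[/trivIsetP] := Bfam; move=> + _; apply. Qed.

(** From [6 n - 10 <= n (n - 1)] follows [(n - 2) (n - 5) >= 0], and [n > 2]. *)
Lemma size_ge5 : 4 < n.
Proof.
have /andP[n3 Bd] := Bdense.
have : degsum B <= n * n.-1.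
  rewrite /degsum -sum_nat_const; apply: leq_sum => X XB.
  rewrite -ltnS prednK; last by rewrite card_gt0; apply/set0Pn; exists X.
  apply: proper_card; apply/properP; split; first by apply/subsetP => Y; rewrite inE => /andP[].
  by exists X => //; rewrite !inE eqxx andbF.
move: n3 Bd; rewrite -/n; case: n => [|[|[|[|[|k]]]]] //=; lia.
Qed.

Lemma familyS B' : B' \subset B -> branch_family B'.
Proof.
move=> /subsetP B'B; apply/andP; split; last by apply/forall_inP => X /B'B /branchB.
by apply/trivIsetP => X Y /B'B XB /B'B YB; apply: disjB.
Qed.

(** Deleting a member of degree at most 3 lowers the degree sum by at most 6, so the smaller family
    would still be dense. *)
Lemma degree_ge4 X : X \in B -> 3 < #|nb B X|.
Proof.
move=> XB; rewrite ltnNge; apply/negP => deg3.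
have BE : B = X |: (B :\ X) by rewrite setD1K.
have nE : n = #|B :\ X|.+1 by rewrite /n (cardsD1 X) XB.
have := Bmin (familyS (subsetDl B [set X])); rewrite -/n nE ltnn.
have := Bdense; rewrite /dense -/n => /andP[_].
have nbE : nb B X = nb (B :\ X) X by rewrite {1}BE nb_self.
rewrite {1}BE degsumU1 ?inE ?eqxx // -nbE nE => Bd H; suff /H : dense (B :\ X) by [].
apply/andP; split; first by have := size_ge5; rewrite nE; clear; lia.
by move: Bd deg3; clear; lia.
Qed.

(* Merging [X] and [Y] loses one edge, plus one for each common neighbour. *)
Lemma codegree X Y : X \in B -> Y \in nb B X ->
  degsum B + 14 < 6 * n + #|nb B X :&: nb B Y|.*2.
Proof.
move=> XB; rewrite inE => /and3P[YB YX XtY]; rewrite ltnNge; apply/negP => cle.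
pose B0 := B :\ X :\ Y; pose Z := X :|: Y.
have YBX : Y \in B :\ X by rewrite !inE YX.
have BE : B = X |: (Y |: B0) by rewrite !setD1K.
have B0B : B0 \subset B by apply: subset_trans (subsetDl _ _) (subsetDl _ _).
have nE : n = #|B0|.+2 by rewrite /n (cardsD1 X) XB (cardsD1 Y) YBX.
have XB0 : X \notin Y |: B0 by rewrite !inE eqxx andbF orbF eq_sym.
have YB0 : Y \notin B0 by rewrite !inE eqxx.
have dZ W : W \in B0 -> [disjoint Z & W].
  rewrite !inE => /and3P[WY WX WB]; rewrite -setI_eq0 setIUl setU_eq0 !setI_eq0.
  by rewrite !disjB // eq_sym.
have ZB0 : Z \notin B0.
  apply/negP => /dZ; rewrite -setI_eq0 setIid setU_eq0 => /andP[/eqP X0 _].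
  by have := branchB XB; rewrite /branch X0 eqxx.
have famZ : branch_family (Z |: B0).
  have /andP[/trivIsetP triv /forall_inP br] := familyS B0B.
  apply/andP; split; last first.
    apply/forall_inP => W; rewrite inE => /orP[/set1P ->|]; last exact: br.
    by apply: branchU => //; apply: branchB.
  apply/trivIsetP => W W'; rewrite !in_setU1 => /orP[/eqP ->|WB] /orP[/eqP ->|W'B].
  - by rewrite eqxx.
  - by move=> _; apply: dZ.
  - by move=> _; rewrite disjoint_sym; apply: dZ.
  - exact: triv.
have := Bmin famZ; rewrite cardsU1 ZB0 add1n -/n nE ltnn => H; suff /H : dense (Z |: B0) by [].
apply/andP; split; first by have := size_ge5; rewrite nE cardsU1 ZB0 add1n; clear; lia.
have nbZ : nb B0 Z = nb B0 X :|: nb B0 Y.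
  apply/setP => W; rewrite !inE touchUl; case: (boolP (W \in B)) => WB; rewrite ?andbF //=.
  case: (eqVneq W X) => //= WX; case: (eqVneq W Y) => //= WY.
  case: eqP => //= WZ; move: (ZB0); by rewrite -WZ !inE WX WY WB.
have nbXY : nb B X :&: nb B Y = nb B0 X :&: nb B0 Y.
  by apply/setP => W; rewrite !inE; case: (W == X); case: (W == Y); case: (W \in B);
    rewrite ?andbF.
have mB : degsum B = degsum B0 + #|nb B0 Y|.*2 + #|nb B0 X|.*2 + 2.
  have -> : degsum B = degsum (X |: (Y |: B0)) by rewrite -BE.
  rewrite degsumU1 // degsumU1 //.
  have -> : nb (Y |: B0) X = Y |: nb B0 X.
    by apply/setP => W; rewrite !inE; case: (eqVneq W Y) => [->|] //=; rewrite YX XtY.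
  rewrite cardsU1 !inE eqxx /=; clear; lia.
have := cardsUI (nb B0 X) (nb B0 Y).
rewrite degsumU1 // nbZ; move: cle; rewrite nbXY mB cardsU1 ZB0 nE.
clear; lia.
Qed.

(** Let [d] be the minimum degree. An edge at a member attaining it has at most [d - 1] common
    neighbours, so [codegree] gives [d n < 6 n + 2 d - 16], that is [(d - 6) (n - 2) < -4]. *)
Lemma low_degree : exists2 X, X \in B & #|nb B X| <= 5.
Proof.
have n5 := size_ge5.
have [X0 X0B] : exists X, X \in B by apply/set0Pn; rewrite -card_gt0; apply: leq_trans n5.
have [X XB Xmin] := @arg_minnP _ X0 (mem B) (fun X => #|nb B X|) X0B.
exists X => //.
have nd : n * #|nb B X| <= degsum B.
  by rewrite /n -sum_nat_const; apply: leq_sum => Y /Xmin.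
have [Y YX] : exists Y, Y \in nb B X.
  by apply/set0Pn; rewrite -card_gt0; apply: leq_trans (degree_ge4 XB).
have := codegree XB YX; have /andP[_] := Bdense; rewrite -/n.
have : #|nb B X :&: nb B Y| < #|nb B X|.
  apply: proper_card; apply/properP; split; first exact: subsetIl.
  by exists Y => //; rewrite !inE eqxx !andbF.
move: nd n5; move: #|nb B X| #|nb B X :&: nb B Y| (degsum B) n => d c m k; clear.
nia.
Qed.

(** Every edge of a minimal dense minor lies in three triangles: density cancels against
    [codegree]. *)
Lemma common_nb X Y : X \in B -> Y \in nb B X -> 2 < #|nb B X :&: nb B Y|.
Proof.
move=> XB YX; have := codegree XB YX; have /andP[_] := Bdense; rewrite -/n; clear; lia.
Qed.

Lemma pairwise_family (s : seq {set V}) : uniq s -> {subset s <= B} ->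
  pairwise touch s -> pairwise (fun X Y => [disjoint X & Y] && touch X Y) s.
Proof.
elim: s => //= X s IHs /andP[Xs us] sB /andP[Xts ts].
rewrite IHs // ?andbT => [|Y Ys]; last by apply: sB; rewrite inE Ys orbT.
apply/allP => Y Ys /=; rewrite (allP Xts Y Ys) andbT.
apply: disjB; rewrite ?sB ?inE ?eqxx ?Ys ?orbT //.
by apply: contraNneq Xs => ->.
Qed.

(* The neighbourhood of a vertex of degree at most 5 either contains K4 or has
   exactly five vertices with two of them, [u1] and [u2], not adjacent; in the
   latter case merging [u1] with a third one leaves K4. *)
Lemma K5_of_minimal : exists s, K5_model s.
Proof.
have [X XB X5] := low_degree; pose N := nb B X.
have NB Y : Y \in N -> Y \in B by rewrite inE => /andP[].
have NX Y : Y \in N -> Y != X by rewrite inE => /and3P[].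
have NtX Y : Y \in N -> touch X Y by rewrite inE => /and3P[].
have tY Y : Y \in N -> 2 < #|[set W in N | (W != Y) && touch Y W]|.
  move=> YN; apply: leq_trans (common_nb XB YN) _; apply: subset_leq_card.
  by apply/subsetP => W; rewrite !inE => /andP[/and3P[-> -> ->] /and3P[_ -> ->]].
have [clique|] := boolP [forall Y in N, forall W in N, (W != Y) ==> touch Y W].
  have N4 : 3 < #|N| by apply: degree_ge4.
  pose s := X :: take 4 (enum N).
  have sN : {subset take 4 (enum N) <= N} by move=> Y /mem_take; rewrite mem_enum.
  have us : uniq s.
    rewrite /s cons_uniq take_uniq ?enum_uniq // andbT.
    by apply/negP => /sN /NX; rewrite eqxx.
  have sB : {subset s <= B}.
    by move=> Y; rewrite inE => /orP[/eqP ->//|/sN /NB].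
  exists s; apply/and3P; split.
  - by rewrite /= size_takel // -cardE.
  - by apply/allP => Y /sB; apply: branchB.
  apply: pairwise_family => //; rewrite /s /=; apply/andP; split.
    by apply/allP => Y /sN /NtX.
  have := take_uniq 4 (enum_uniq N); rewrite uniq_pairwise.
  have := sN; elim: (take 4 _) => //= Y r IHr sub /andP[Yr ur].
  rewrite IHr ?andbT // => [|W Wr]; last by apply: sub; rewrite inE Wr orbT.
  apply/allP => W Wr; have /= YW := allP Yr W Wr.
  have YN : Y \in N by apply: sub; rewrite inE eqxx.
  have WN : W \in N by apply: sub; rewrite inE Wr orbT.
  by have /forall_inP/(_ Y YN)/forall_inP/(_ W WN) := clique; rewrite eq_sym YW.
rewrite negb_forall_in => /exists_inP[u1 u1N]; rewrite negb_forall_in => /exists_inP[u2 u2N].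
rewrite negb_imply => /andP[u21 nt12].
(* [M] has at most three members, while [u1] and [u2] each have three neighbours in [N], all of them
   in [M]; so both touch every member of [M]. *)
pose M := N :\ u1 :\ u2.
have M3 : #|M| <= 3.
  have u2N1 : u2 \in N :\ u1 by rewrite in_setD1 u21.
  by move: X5; rewrite (cardsD1 u1) u1N (cardsD1 u2) u2N1.
have MN W : W \in M -> [/\ W \in N, W != u1 & W != u2].
  by rewrite !in_setD1 => /and3P[-> -> ->].
have tM u u' : u \in N -> u != u' -> ~~ touch u u' -> N :\ u :\ u' = M ->
    forall W, W \in M -> touch u W.
  move=> uN uu' ntu EM W WM.
  have sub : [set W in N | (W != u) && touch u W] \subset M.
    rewrite -EM; apply/subsetP => Z; rewrite inE => /and3P[ZN Zu tZ].
    by rewrite !in_setD1 ZN Zu !andbT; apply: contraNneq ntu => <-.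
  have /eqP EE : [set W in N | (W != u) && touch u W] == M.
    by rewrite eqEcard sub (leq_trans M3) // tY.
  by move: WM; rewrite -EE inE => /and3P[].
have t1 : forall W, W \in M -> touch u1 W by apply: (tM u1 u2); rewrite // eq_sym.
have t2 : forall W, W \in M -> touch u2 W.
  apply: (tM u2 u1) => //; first by rewrite touchC.
  by rewrite /M setDDl setUC -setDDl.
have M2 : 2 < #|M|.
  apply: leq_trans (tY _ u1N) _; apply: subset_leq_card; apply/subsetP => W.
  rewrite inE => /and3P[WN W1 tW].
  by rewrite !in_setD1 WN W1 !andbT; apply: contraNneq nt12 => <-.
have [c cM] : exists c, c \in M by apply/set0Pn; rewrite -card_gt0; apply: leq_trans M2.
have [cN c1 c2] := MN _ cM.
(* Of the three neighbours of [c] in [N], at most two are [u1] and [u2]. *)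
have [d dM dc] : exists2 d, d \in M & (d != c) && touch c d.
  have : 0 < #|[set W in N | (W != c) && touch c W] :\ u1 :\ u2|.
    have := tY _ cN; rewrite (cardsD1 u1) (cardsD1 u2 (_ :\ _)).
    by do 2 case: (_ \in _) => /=; clear; lia.
  rewrite card_gt0 => /set0Pn[d]; rewrite 2!in_setD1 inE => /and5P[d2 d1 dN dc tcd].
  by exists d; rewrite ?dc // !in_setD1 d1 d2 dN.
have [w wM [wd wc]] : exists2 w, w \in M & w != d /\ w != c.
  have : 0 < #|M :\ c :\ d|.
    have := M2; rewrite (cardsD1 c) (cardsD1 d (_ :\ _)).
    by do 2 case: (_ \in _) => /=; clear; lia.
  rewrite card_gt0 => /set0Pn[w]; rewrite 2!in_setD1 => /and3P[wd wc wM].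
  by exists w.
(* [Z] touches [X], [c] and [d] through [u1], and [u2] through [w]. *)
pose Z := u1 :|: w.
have [[wN w1 w2] [dN d1 d2]] := (MN _ wM, MN _ dM).
have [dc' tcd] := andP dc.
have tw2 : touch w u2 by rewrite touchC t2.
exists [:: Z; X; u2; c; d]; apply/and3P; split=> //.
  have bZ : branch Z by apply: branchU; [exact/branchB/NB|exact/branchB/NB|exact: t1].
  by rewrite /= bZ (branchB XB) !branchB // NB.
rewrite pairwise_cons; apply/andP; split.
  have disjZ W : W \in B -> W != u1 -> W != w -> [disjoint Z & W].
    move=> WB W1 Ww; rewrite -setI_eq0 setIUl setU_eq0 !setI_eq0.
    rewrite (disjB (NB _ u1N) WB); last by rewrite eq_sym.
    by rewrite (disjB (NB _ wN) WB) // eq_sym.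
  have [dX du2 dc'' dd] : [/\ [disjoint Z & X], [disjoint Z & u2],
      [disjoint Z & c] & [disjoint Z & d]].
    split; apply: disjZ => //; rewrite ?(NB _ u2N) ?(NB _ cN) ?(NB _ dN) //.
    - by rewrite eq_sym NX.
    - by rewrite eq_sym NX.
    - by rewrite eq_sym.
    - by rewrite eq_sym.
    - by rewrite eq_sym.
  by rewrite /= dX du2 dc'' dd !touchUl (touchC u1 X) NtX // tw2 (t1 _ cM) (t1 _ dM) orbT.
apply: pairwise_family.
- rewrite /= !inE !negb_or !(eq_sym X) !NX // !(eq_sym u2) c2 d2 !(eq_sym c) dc' //.
- by move=> W; rewrite !inE => /or4P[] /eqP -> //; rewrite NB.
- by rewrite /= !NtX // !t2 // tcd.
Qed.

End MinimalFamily.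
(** The singletons form a dense family; a smallest dense family of branch sets is then the minimal
    minor studied above. *)
Lemma K5_of_degree_ge6 : irreflexive adj -> 2 < #|V| ->
  (forall v, 5 < #|[set w | adj v w]|) -> exists s, K5_model s.
Proof.
move=> adj_irr V3 deg6; pose B0 := [set [set v] | v : V].
have cardB0 : #|B0| = #|V| by rewrite card_imset //; apply: set1_inj.
have B0P : branch_family B0 && dense B0.
  rewrite /branch_family /dense cardB0 V3 /=; apply/andP; split.
    apply/andP; split; last by apply/forall_inP => X /imsetP[v _ ->]; apply: branch1.
    apply/trivIsetP => X Y /imsetP[v _ ->] /imsetP[w _ ->].
    by rewrite disjoints1 inE; apply: contra_neqN => /eqP ->.
  rewrite mulnC -cardB0 /degsum -sum_nat_const; apply: leq_trans (leq_addr _ _).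
  apply: leq_sum => X /imsetP[v _ ->]; apply: leq_trans (deg6 v) _.
  rewrite -(card_imset _ (@set1_inj V)); apply: subset_leq_card.
  apply/subsetP => Y /imsetP[w]; rewrite inE => vw ->; rewrite inE imset_f //=.
  apply/andP; split; last by apply/touchP; exists v, w; rewrite !inE.
  by apply: contraTneq vw => /set1_inj ->; rewrite adj_irr.
have [B /andP[Bf Bd] Bmin] := @arg_minnP _ B0
  (fun B => branch_family B && dense B) (fun B => #|B|) B0P.
by apply: (K5_of_minimal Bf Bd) => B' B'f B'd; apply: Bmin; rewrite B'f.
Qed.

End CompleteMinor.

(** * Passage to simple graphs: minima, trees and edge cuts *)

Lemma bigminn_le (I : finType) (P : pred I) (f : I -> nat) m i :
  P i -> \big[minn/m]_(j | P j) f j <= f i.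
Proof.
move=> Pi; have : i \in index_enum I by rewrite mem_index_enum.
elim: (index_enum I) => // j r IHr; rewrite inE big_cons => /orP[/eqP <-|/IHr ir].
  by rewrite Pi geq_minl.
by case: ifP => // _; apply: leq_trans ir; apply: geq_minr.
Qed.

Lemma bigminn_le_default (I : finType) (P : pred I) (f : I -> nat) m :
  \big[minn/m]_(j | P j) f j <= m.
Proof.
elim: (index_enum I) => [|j r IHr]; first by rewrite big_nil.
by rewrite big_cons; case: ifP => // _; apply: leq_trans IHr; apply: geq_minr.
Qed.

Lemma leq_bigminn (I : finType) (P : pred I) (f : I -> nat) m k :
  k <= m -> (forall i, P i -> k <= f i) -> k <= \big[minn/m]_(j | P j) f j.
Proof.
move=> km kf; apply: (big_ind (leq k)) => // x y kx ky; by rewrite leq_min kx.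
Qed.

Section SimpleGraph.
Variables (V : finType) (adj : rel V).
Variables (s t : {set V} -> V).
Hypothesis endsE : {in edges adj, forall d : {set V}, d = [set s d; t d]}.
Implicit Types (X S : {set V}) (F G : {set {set V}}).

Lemma crosses_edge u v X : [set u; v] \in edges adj ->
  crosses s t X [set u; v] = (u \in X) (+) (v \in X).
Proof.
move=> dE; have := endsE dE; set d := [set u; v] => dst.
have dE' z : (z \in d) = (z \in [set s d; t d]) by rewrite {1}dst.
have : s d \in d by rewrite dE' !inE eqxx.
have : t d \in d by rewrite dE' !inE eqxx orbT.
have : u \in [set s d; t d] by rewrite -dE' !inE eqxx.
have : v \in [set s d; t d] by rewrite -dE' !inE eqxx orbT.
pose c := congr1 (fun z => z \in X).
rewrite /crosses !inE => /orP[]/eqP/c e1 /orP[]/eqP/c e2 /orP[]/eqP/c e3 /orP[]/eqP/c e4;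
  by move: e1 e2 e3 e4 => /=; do 4 case: (_ \in X).
Qed.

Lemma connect_uncrossed G X : G \subset edges adj ->
  {in G, forall d, ~~ crosses s t X d} ->
  forall u v, connect (edge_rel G) u v -> (u \in X) = (v \in X).
Proof.
move=> /subsetP GE GX u v /connectP[p + ->]; elim: p u => //= w p IHp u /andP[uw /IHp <-].
have := GX _ uw; rewrite crosses_edge ?GE //.
by case: (u \in X); case: (w \in X).
Qed.

Lemma edge_rel_sym G : connect_sym (edge_rel G).
Proof. by apply: sym_connect_sym => u v; rewrite /edge_rel setUC. Qed.

(** Every step of the path starts at a vertex other than [x] and [y], so the rest of a cycle avoids
    its edge from [x] to [y]. *)
Lemma cycle_rest (x y z : V) G q :
  x \notin z :: q -> y \notin z :: q -> path (edge_rel G) z (rcons q x) ->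
  path (edge_rel (G :\ [set x; y])) z (rcons q x).
Proof.
have step u w : x != u -> y != u -> edge_rel G u w -> edge_rel (G :\ [set x; y]) u w.
  rewrite /edge_rel in_setD1 => xu yu ->; rewrite andbT.
  by apply/eqP => /setP/(_ u); rewrite !inE eqxx !(eq_sym u) (negbTE xu) (negbTE yu).
elim: q z => [|w q IHq] z; rewrite !inE ?negb_or /=.
  by rewrite !andbT => xz yz; apply: step.
move=> /andP[xz xq] /andP[yz yq] /andP[zw wq]; rewrite step //=.
by apply: IHq; rewrite // inE negb_or.
Qed.

(** A smallest subset of [G] linking [S], with the component of one terminal as vertex set, is a
    tree: an edge outside the component or on a cycle could be dropped. *)
Lemma tree_of_linked S G : S != set0 -> G \subset edges adj ->
  {in S &, forall u v, linked s t G u v} ->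
  exists2 T, tree_connecting adj S T & T.2 \subset G.
Proof.
move=> /set0Pn[a aS] GE GL.
pose Q (G' : {set {set V}}) := (G' \subset G) &&
  `[< {in S &, forall u v, linked s t G' u v} >].
have QG : Q G by rewrite /Q subxx; apply/asboolP.
have [F /andP[FG /asboolP FL] Fmin] := arg_minnP (fun F : {set {set V}} => #|F|) QG.
have FE := subset_trans FG GE.
have keep d : d \in F -> ~ {in S &, forall u v, linked s t (F :\ d) u v}.
  move=> dF FdL; have : Q (F :\ d).
    by rewrite /Q (subset_trans (subsetDl _ _) FG); apply/asboolP.
  by move=> /Fmin; rewrite [#|F|](cardsD1 d) dF ltnn.
pose W := [set y | connect (edge_rel F) a y].
have aW : a \in W by rewrite inE.
have WF d : d \in F -> (s d \in W) = (t d \in W).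
  move=> dF; rewrite !inE; apply: same_connect_r; first exact: edge_rel_sym.
  by apply: connect1; rewrite /edge_rel -endsE ?(subsetP FE).
have SW v : v \in S -> v \in W.
  move=> vS; case: (boolP (v \in W)) => // vW.
  have [d dF] := FL a v aS vS W aW vW.
  by rewrite /crosses WF // addbb.
exists (W, F) => //; split=> //.
- split=> //= d dF; rewrite [d]endsE ?(subsetP FE) //.
  have sW : s d \in W.
    (* Were [d] outside [W], testing [X :&: W] instead of [X] would give a crossing edge inside [W],
       hence different from [d]. *)
    case: (boolP (s d \in W)) => // sW; case: (keep d dF) => u v uS vS X uX vX.
    have [||e eF ce] := FL u v uS vS (X :&: W).
    + by rewrite inE uX SW.
    + by rewrite inE (negbTE vX).
    have eW : s e \in W.
      by move: ce; rewrite /crosses !(in_setI _ X W) -WF //; case: (s e \in W); rewrite ?andbF.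
    have tW : t e \in W by rewrite -WF.
    exists e; last by move: ce; rewrite /crosses !(in_setI _ X W) eW tW !andbT.
    by rewrite !inE eF andbT; apply: contraNneq sW => <-.
  by apply/subsetP => z; rewrite in_set2 => /orP[] /eqP ->; rewrite -?WF.
- split; first by apply/set0Pn; exists a.
    move=> u v; rewrite !inE => au av; apply: connect_trans av.
    by rewrite edge_rel_sym.
  case=> [|x [|y [|z q]]] // _ /=; rewrite !inE !negb_or.
  move=> /and4P[/and3P[xy xz xq] /andP[yz yq] zq uq]; apply/negP => /and3P[xyF yzF zF].
  have q' : path (edge_rel (F :\ [set x; y])) z (rcons q x).
    by apply: cycle_rest; rewrite ?inE ?negb_or ?xz ?yz.
  have yz' : edge_rel (F :\ [set x; y]) y z.
    move: yzF; rewrite /edge_rel in_setD1 => ->; rewrite andbT; apply/eqP => /setP/(_ z).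
    by rewrite !inE eqxx orbT !(eq_sym z) (negbTE xz) (negbTE yz).
  have yx : connect (edge_rel (F :\ [set x; y])) y x.
    by apply/connectP; exists (z :: rcons q x); rewrite /= ?yz' ?q' // last_rcons.
  apply: (keep _ xyF) => u v uS vS X uX vX; apply: contrapT => noX.
  (* If only the edge from [x] to [y] could cross [X], the rest of the cycle would keep [x] and [y]
     on the same side, so that edge would not cross [X] either. *)
  have nocross : {in F :\ [set x; y], forall d, ~~ crosses s t X d}.
    by move=> d dF; apply/negP => cd; apply: noX; exists d.
  have FxyE := subset_trans (subsetDl F [set [set x; y]]) FE.
  have xyX := connect_uncrossed FxyE nocross yx.
  have [d dF cd] := FL u v uS vS X uX vX.
  have [dxy|dxy] := eqVneq d [set x; y].
    by move: cd; rewrite dxy crosses_edge ?(subsetP FE) // xyX addbb.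
  by have := nocross d; rewrite in_setD1 dxy dF cd => /(_ isT).
by apply/subsetP => v vS; apply: SW.
Qed.

Lemma edge_connectivity_le_cut X x y : x \in X -> y \notin X ->
  edge_connectivity adj <= cut s t (edges adj) X.
Proof.
move=> xX yX; rewrite cutE; set D := [set d in _ | _].
apply: (bigminn_le (fun F => #|F|)); apply/andP; split.
  by apply/subsetP => d; rewrite inE => /andP[].
apply/asboolP => conn.
have := connect_uncrossed (X := X) (subsetDl (edges adj) D) _ (conn x y _ _).
rewrite xX (negbTE yX) => H; suff : true = false by []; apply: H; rewrite ?inE //.
move=> d; rewrite in_setD => /andP[dD dE]; apply: contra dD => cd.
by rewrite inE dE.
Qed.

Lemma lambda_set_ge S : #|S| = 3 -> edge_connectivity adj <= 5 ->
  edge_connectivity adj - 1 <= lambda_set adj S.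
Proof.
move=> S3 k5; set k := edge_connectivity adj.
have [|G [GE Gd] GL] := three_terminal_packing (s := s) (t := t) (F := edges adj) S3 k5.
  move=> X XS; have [x] : exists x, x \in X :&: S.
    by apply/set0Pn; rewrite -card_gt0 XS.
  rewrite inE => /andP[xX _].
  have [y] : exists y, y \in S :\: X.
    by apply/set0Pn; rewrite -card_gt0 cardsD setIC XS S3.
  by rewrite inE => /andP[yX _]; apply: edge_connectivity_le_cut xX yX.
have S0 : S != set0 by rewrite -card_gt0 S3.
have /fin_all_exists2[T Ttree TG] i := tree_of_linked S0 (GE i) (GL i).
have [a aS] := set0Pn _ S0.
have [b] : exists b, b \in S :\ a.
  by apply/set0Pn; rewrite -card_gt0; move: S3; rewrite (cardsD1 a) aS; lia.
rewrite !inE => /andP[ba bS].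
(* Two terminals force an edge in each tree, so disjoint trees are distinct and the set of trees has
   [k - 1] elements. *)
have T0 i : (T i).2 != set0.
  have [_ [_ Tc _] /subsetP ST] := Ttree i; apply: contra ba => /eqP T0.
  have /connectP[[|c p] /=] := Tc a b (ST _ aS) (ST _ bS); first by move=> _ ->.
  by rewrite /edge_rel T0 inE.
have Tdis i j : i != j -> [disjoint (T i).2 & (T j).2].
  by move=> /Gd; apply: disjointW; apply: TG.
have T_inj : injective T.
  move=> i j Tij; apply/eqP; apply: contraT => /Tdis.
  by rewrite Tij -setI_eq0 setIid (negbTE (T0 j)).
rewrite subn1 -[k.-1]card_ord -(card_imset _ T_inj).
apply: (leq_bigmax_cond (F := fun P : {set subgraph_type V} => #|P|)).
apply/asboolP; split=> [_ /imsetP[i _ ->] //|].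
by move=> _ _ /imsetP[i _ ->] /imsetP[j _ ->] Tij; apply: Tdis; apply: contra_neq Tij => ->.
Qed.

Lemma edge_connectivity_le_degree v w : irreflexive adj -> symmetric adj -> v != w ->
  edge_connectivity adj <= #|[set u | adj v u]|.
Proof.
move=> adj_irr adj_sym vw.
apply: (leq_trans (@edge_connectivity_le_cut [set v] v w _ _)); rewrite ?inE // 1?eq_sym //.
rewrite cutE -(card_in_imset (f := fun u => [set v; u])); last first.
  move=> u u'; rewrite !inE => vu vu' /setP/(_ u); rewrite !inE eqxx orbT.
  by case: (eqVneq u v) vu => [->|_ _]; [rewrite adj_irr|move=> /esym/eqP].
apply: subset_leq_card; apply/subsetP => d; rewrite inE => /andP[/imsetP[[x y]]].
rewrite inE /= => xy -> ; rewrite crosses_edge; last first.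
  by apply/imsetP; exists (x, y); rewrite ?inE.
rewrite !inE; case: (eqVneq x v) xy => [->|_] xy.
  by move=> _; apply/imsetP; exists y; rewrite ?inE.
case: (eqVneq y v) xy => // -> xy _; apply/imsetP; exists x; last by rewrite setUC.
by rewrite inE adj_sym.
Qed.

(** Each tree contains an edge of [F], since it joins [x] to [y]; choosing one is injective on
    disjoint trees. *)
Lemma lambda_set_le_cut S F x y : x \in S -> y \in S ->
  ~~ connect (edge_rel (edges adj :\: F)) x y -> lambda_set adj S <= #|F|.
Proof.
move=> xS yS nxy; apply/bigmax_leqP => P /asboolP[Ptree Pdis].
have TF T : T \in P -> exists d, d \in T.2 :&: F.
  move=> /Ptree[[TE _] [_ Tc _] /subsetP ST]; apply/set0Pn.
  apply: contra nxy; rewrite setI_eq0 disjoints_subset => TF.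
  apply: connect_sub (Tc _ _ (ST _ xS) (ST _ yS)) => u v uv; apply: connect1.
  by rewrite /edge_rel inE (subsetP TE _ uv) andbT -in_setC (subsetP TF).
pose f (T : subgraph_type V) := odflt set0 [pick d in T.2 :&: F].
have fP T : T \in P -> f T \in T.2 :&: F.
  move=> TP; rewrite /f; case: pickP => //= none; have [d dT] := TF T TP.
  by have := none d; rewrite dT.
have f_inj : {in P &, injective f}.
  move=> T T' TP TP' ff; apply/eqP; apply: contraT => TT'.
  have /pred0P/(_ (f T)) := Pdis _ _ TP TP' TT'; have := fP _ TP; have := fP _ TP'.
  by rewrite -ff !inE /= => /andP[-> _] /andP[-> _].
rewrite -(card_in_imset f_inj); apply: subset_leq_card.
by apply/subsetP => _ /imsetP[T TP ->]; have := fP T TP; rewrite inE => /andP[].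
Qed.

Lemma lambda3_le_edge_connectivity : 2 < #|V| -> lambda3 adj <= edge_connectivity adj.
Proof.
(* Both minima have the default [#|edges adj|]. For a disconnecting [F], a separated pair and any
   third vertex form the terminal set. *)
move=> V3; apply: leq_bigminn; first exact: bigminn_le_default.
move=> F /andP[_ /asboolP nconn].
have [x [y nxy]] : exists x y, ~~ connect (edge_rel (edges adj :\: F)) x y.
  apply: contrapT => H; apply: nconn => x y _ _; apply: contrapT => nxy.
  by apply: H; exists x, y; apply/negP.
have xy : x != y by apply: contraNneq nxy => ->.
have [z] : exists z, z \in ~: [set x; y].
  apply/set0Pn; rewrite -card_gt0; have := cardsC [set x; y].
  by rewrite cards2 xy; lia.
rewrite !inE negb_or => /andP[zx zy].
apply: leq_trans (@lambda_set_le_cut (z |: [set x; y]) F x y _ _ nxy).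
- by apply: bigminn_le; rewrite cardsU1 cards2 !inE negb_or zx zy xy.
- by rewrite !inE eqxx orbT.
- by rewrite !inE eqxx !orbT.
Qed.

End SimpleGraph.

Lemma edges_ends (V : finType) (adj : rel V) : 0 < #|V| ->
  exists s t : {set V} -> V, {in edges adj, forall d : {set V}, d = [set s d; t d]}.
Proof.
move=> /card_gt0P[v0 _].
have /choice[f fP] (d : {set V}) :
    exists z : V * V, d \in edges adj -> d = [set z.1; z.2].
  case: (boolP (d \in edges adj)) => [/imsetP[z _ dz]|_]; first by exists z.
  by exists (v0, v0).
by exists (fun d => (f d).1), (fun d => (f d).2) => d /fP.
Qed.

(** * Chains of close points and the parity argument for K5 *)

Section Chains.
Import Order.TTheory GRing.Theory Num.Theory.
Local Open Scope ring_scope.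
Variable R : realFieldType.
Implicit Types (p q a b c d v : R * R) (L : seq (R * R)).

(* Breaking ties of abscissas by the height spares any general position
   assumption on the drawing. *)
Definition lexlt p q : bool := (p.1 < q.1) || ((p.1 == q.1) && (p.2 < q.2)).

Lemma lexltC p q : p != q -> lexlt q p = ~~ lexlt p q.
Proof.
case: p q => [x y] [x' y']; rewrite xpair_eqE /lexlt /= negb_and.
by case: (ltgtP x x') => //= _; case: (ltgtP y y').
Qed.

Lemma lexlt_fst p q : p.1 < q.1 -> lexlt p q = true /\ lexlt q p = false.
Proof. by move=> pq; rewrite /lexlt pq (lt_gtF pq) (gt_eqF pq). Qed.

Definition near_pts (e : R) p q : bool := (`|p.1 - q.1| < e) && (`|p.2 - q.2| < e).

(** With the factor 3, a gap in the same coordinate and direction survives when both points move by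
    less than [e]. *)
Definition far_pts (e : R) p q : bool :=
  (3 * e <= `|p.1 - q.1|) || (3 * e <= `|p.2 - q.2|).

Lemma near_ptsC e p q : near_pts e p q = near_pts e q p.
Proof. by rewrite /near_pts distrC (distrC p.2). Qed.

(* The height of [v] is compared with that of [c] only, which is accurate when
   [v] is far from the short step from [c] to [d]. *)
Definition above v c d : bool := (lexlt c v (+) lexlt d v) && (v.2 < c.2).

(** Parity of the steps of the chain [c :: L] that pass above [v]. *)
Fixpoint winding v c L : bool :=
  if L is d :: L' then above v c d (+) winding v d L' else false.

(** If the steps are apart horizontally, both sides vanish. If they are apart vertically, only the
    tests of the ends of the lower step remain, and these add up to the four comparisons. *)
Lemma above_far e a b c d : 
  near_pts e a b -> near_pts e c d -> far_pts e a c ->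
  above a c d (+) above b c d (+) above c a b (+) above d a b =
  lexlt a c (+) lexlt b c (+) lexlt a d (+) lexlt b d.
Proof.
move=> /andP[]; rewrite !ltr_norml => /andP[ab1 ab2] /andP[ab3 ab4].
move=> /andP[]; rewrite !ltr_norml => /andP[cd1 cd2] /andP[cd3 cd4].
rewrite /far_pts !ler_normr => /orP[] /orP[] ac.
- have [ca da cb db] : [/\ c.1 < a.1, d.1 < a.1, c.1 < b.1 & d.1 < b.1] by split; lra.
  by rewrite /above !(lexlt_fst ca).1 !(lexlt_fst da).1 !(lexlt_fst cb).1 !(lexlt_fst db).1
    !(lexlt_fst ca).2 !(lexlt_fst da).2 !(lexlt_fst cb).2 !(lexlt_fst db).2.
- have [ca da cb db] : [/\ a.1 < c.1, a.1 < d.1, b.1 < c.1 & b.1 < d.1] by split; lra.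
  by rewrite /above !(lexlt_fst ca).1 !(lexlt_fst da).1 !(lexlt_fst cb).1 !(lexlt_fst db).1
    !(lexlt_fst ca).2 !(lexlt_fst da).2 !(lexlt_fst cb).2 !(lexlt_fst db).2.
- have [ca da cb] : [/\ c.2 < a.2, d.2 < a.2 & c.2 < b.2] by split; lra.
  rewrite /above ca da (lt_gtF ca) (lt_gtF cb) !andbF !andbT /=.
  by rewrite -!addbA.
have [ca da cb db] : [/\ a.2 < c.2, a.2 < d.2, b.2 < c.2 & b.2 < d.2] by split; lra.
have neq x y : x.2 < y.2 -> x != y :> R * R by move=> xy; apply: contraTneq xy => ->; rewrite ltxx.
rewrite /above ca cb (lt_gtF ca) (lt_gtF da) !andbF !andbT !addbF.
rewrite (lexltC (neq _ _ ca)) (lexltC (neq _ _ da)) (lexltC (neq _ _ cb)) (lexltC (neq _ _ db)).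
by case: (lexlt a c); case: (lexlt b c); case: (lexlt a d); case: (lexlt b d).
Qed.

(** Addition of two equations over F2, as used in the telescoping inductions on chains. *)
Lemma addb_combine (x1 y1 x2 y2 x y : bool) :
  x1 = y1 -> x2 = y2 -> xorb x y = xorb (xorb x1 y1) (xorb x2 y2) -> x = y.
Proof. by move=> -> ->; case: x; case: y; case: y1; case: y2. Qed.

Lemma addbE (x y : bool) : x (+) y = xorb x y. Proof. by case: x; case: y. Qed.

Lemma winding_step e a b c L :
  near_pts e a b -> path (near_pts e) c L -> all (far_pts e a) (c :: L) ->
  winding a c L (+) winding b c L (+) above c a b (+) above (last c L) a b =
  lexlt a c (+) lexlt b c (+) lexlt a (last c L) (+) lexlt b (last c L).
Proof.
move=> ab; elim: L c => [|d L IHL] c /=.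
  by move=> _ _; case: above; case: lexlt; case: lexlt.
move=> /andP[cd dL] /andP[ac adL].
apply: (addb_combine (above_far ab cd ac) (IHL d dL adL)).
by rewrite !addbE; btauto.
Qed.

(** Summing the identity for single steps over both chains, all terms at inner points cancel modulo
    2, and only the order of the four chain ends remains. *)
Lemma winding_far e a L c M :
  path (near_pts e) a L -> path (near_pts e) c M ->
  all (fun p => all (far_pts e p) (c :: M)) (a :: L) ->
  winding a c M (+) winding (last a L) c M (+)
    winding c a L (+) winding (last c M) a L =
  lexlt a c (+) lexlt (last a L) c (+) lexlt a (last c M) (+)
    lexlt (last a L) (last c M).
Proof.
elim: L a => [|b L IHL] a.
  by move=> _ _ _ /=; case: winding; case: lexlt; case: lexlt.
move=> /= /andP[ab bL] cM /andP[acM bLcM].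
apply: (addb_combine (winding_step ab cM acM) (IHL b bL cM bLcM)).
by rewrite !addbE; btauto.
Qed.

(* Summing the parities of [winding_far] over the 15 pairs of disjoint edges of
   K5, each winding term occurs twice, while each of the five 4-subsets of
   vertices contributes exactly one interleaved pairing in any linear order. *)
Lemma K5_chains e (v : nat -> R * R) (L : nat -> nat -> seq (R * R)) :
  (forall i j, i < j < 5 -> path (near_pts e) (v i) (L i j))%N ->
  (forall i j, i < j < 5 -> last (v i) (L i j) = v j)%N ->
  (forall i j, i < j < 5 -> v i != v j)%N ->
  (forall i j k l, i < j < 5 -> k < l < 5 -> uniq [:: i; j; k; l] ->
    all (fun p => all (far_pts e p) (v k :: L k l)) (v i :: L i j))%N -> False.
Proof.
move=> pathL lastL v_neq farL.
have E i j k l : (i < j < 5 -> k < l < 5 -> uniq [:: i; j; k; l])%N ->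
  (i < j < 5)%N -> (k < l < 5)%N ->
  winding (v i) (v k) (L k l) (+) winding (v j) (v k) (L k l) (+)
    winding (v k) (v i) (L i j) (+) winding (v l) (v i) (L i j) =
  lexlt (v i) (v k) (+) lexlt (v j) (v k) (+) lexlt (v i) (v l) (+) lexlt (v j) (v l).
  move=> u ij kl; have := winding_far (pathL _ _ ij) (pathL _ _ kl) (farL _ _ _ _ ij kl (u ij kl)).
  by rewrite !lastL.
have C i j : (i < j < 5)%N -> lexlt (v j) (v i) = ~~ lexlt (v i) (v j).
  by move=> /v_neq /lexltC.
have := congr2 addb (E 0 1 2 3 (fun _ _ => isT) isT isT)
  (congr2 addb (E 0 2 1 3 (fun _ _ => isT) isT isT)
  (congr2 addb (E 0 3 1 2 (fun _ _ => isT) isT isT)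
  (congr2 addb (E 0 1 2 4 (fun _ _ => isT) isT isT)
  (congr2 addb (E 0 2 1 4 (fun _ _ => isT) isT isT)
  (congr2 addb (E 0 4 1 2 (fun _ _ => isT) isT isT)
  (congr2 addb (E 0 1 3 4 (fun _ _ => isT) isT isT)
  (congr2 addb (E 0 3 1 4 (fun _ _ => isT) isT isT)
  (congr2 addb (E 0 4 1 3 (fun _ _ => isT) isT isT)
  (congr2 addb (E 0 2 3 4 (fun _ _ => isT) isT isT)
  (congr2 addb (E 0 3 2 4 (fun _ _ => isT) isT isT)
  (congr2 addb (E 0 4 2 3 (fun _ _ => isT) isT isT)
  (congr2 addb (E 1 2 3 4 (fun _ _ => isT) isT isT)
  (congr2 addb (E 1 3 2 4 (fun _ _ => isT) isT isT)
  (E 1 4 2 3 (fun _ _ => isT) isT isT)))))))))))))).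
(* All comparisons are expressed by those of a smaller with a larger index; then the left sides sum
   to 0 and the right sides to 1. *)
rewrite ?(C 0 1 isT) ?(C 0 2 isT) ?(C 0 3 isT) ?(C 0 4 isT) ?(C 1 2 isT)
  ?(C 1 3 isT) ?(C 1 4 isT) ?(C 2 3 isT) ?(C 2 4 isT) ?(C 3 4 isT).
set l := (X in X = _); set r := (X in _ = X).
have -> : l = false by rewrite /l !addbE; btauto.
have -> : r = true by rewrite /r !addbE; btauto.
by [].
Qed.
End Chains.

From mathcomp Require Import all_classical all_reals all_analysis.

(** * Discretizing curves and separating compact sets *)

Section Curves.
Import Order.TTheory GRing.Theory Num.Theory.
Import numFieldNormedType.Exports.
Local Open Scope ring_scope.
Local Open Scope classical_set_scope.
Variable R : realType.
Implicit Types (g : R -> R * R) (e : R).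

Lemma near_pts_norm e (p q : R * R) : `|p - q| < e -> near_pts e p q.
Proof. by rewrite prod_normE gt_max => /andP[pq1 pq2]; rewrite /near_pts pq1. Qed.

Lemma far_pts_norm e (p q : R * R) : 3 * e <= `|p - q| -> far_pts e p q.
Proof. by rewrite prod_normE le_max. Qed.

Lemma curve_uniform g e : 0 < e -> {within `[0, 1], continuous g} ->
  exists n : nat, forall s t, 0 <= s <= 1 -> 0 <= t <= 1 ->
    `|s - t| <= n.+1%:R^-1 -> near_pts e (g s) (g t).
Proof.
move=> e0 cg; have /compact_near_coveringP cov := @segment_compact R 0 1.
pose P (n : nat) (s : R) := forall t, 0 <= s <= 1 -> 0 <= t <= 1 ->
    `|s - t| <= n.+1%:R^-1 -> near_pts e (g s) (g t).
have /filter_ex[n nP] : \forall n \near \oo, `[0, 1] `<=` P n.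
  apply: cov => x xI.
  have e2 : 0 < e / 2 by rewrite divr_gt0.
  have := (subspace_continuousP _ _).1 cg x xI.
  move=> /cvgrPdist_lt/(_ _ e2); rewrite near_withinE => /nbhs_ballP[d /= d0 xd].
  have d2 : 0 < d / 2 by rewrite divr_gt0.
  have nd := near_infty_natSinv_lt (PosNum d2).
  exists (ball x (d / 2), [set n | n.+1%:R^-1 < d / 2]); first by split => //; exact: nbhsx_ballx.
  move=> [s n] [/= xs dn] t sI tI st.
  have near_x u : 0 <= u <= 1 -> `|x - u| < d -> near_pts (e / 2) (g x) (g u).
    by move=> uI xu; apply: near_pts_norm; apply: xd => //=; rewrite in_itv.
  have xsd : `|x - s| < d by apply: lt_le_trans xs _; lra.
  have xtd : `|x - t| < d.
    have -> : x - t = (x - s) + (s - t) by ring.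
    apply: le_lt_trans (ler_normD _ _) _.
    by rewrite [ltRHS](splitr d) ltrD // (le_lt_trans st).
  have /andP[] := near_x _ sI xsd; have /andP[] := near_x _ tI xtd.
  rewrite /near_pts !ltr_norml; clear => /andP[t1 t2] /andP[t3 t4] /andP[s1 s2] /andP[s3 s4].
  by apply/andP; split; apply/andP; split; lra.
exists n => s t sI; apply: (nP s) => //=; by rewrite in_itv.
Qed.

Lemma curve_chain g e : 0 < e -> {within `[0, 1], continuous g} ->
  exists L, [/\ path (near_pts e) (g 0) L, last (g 0) L = g 1 &
    forall p, p \in g 0 :: L -> exists2 t, 0 <= t <= 1 & p = g t].
Proof.
move=> e0 cg; have [n nP] := curve_uniform e0 cg.
pose u k : R := k%:R / n.+1%:R.
have u0 : u 0%N = 0 by rewrite /u mul0r.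
have u1 : u n.+1 = 1 by rewrite /u divff.
have uI k : (k <= n.+1)%N -> 0 <= u k <= 1.
  by move=> kn; rewrite /u divr_ge0 //= ler_pdivrMr // mul1r ler_nat.
have chain m : (m <= n.+1)%N -> exists L, [/\ path (near_pts e) (g 0) L, last (g 0) L = g (u m) &
    forall p, p \in g 0 :: L -> exists2 t, 0 <= t <= 1 & p = g t].
  elim: m => [|m IHm] mn.
    exists [::]; split=> //=; first by rewrite u0.
    by move=> p; rewrite inE => /eqP ->; exists 0; rewrite ?lexx ?ler01.
  have [L [pL lL LI]] := IHm (ltnW mn); exists (rcons L (g (u m.+1))); split.
  - rewrite rcons_path pL lL /=; apply: nP; rewrite ?uI ?(ltnW mn) //.
    rewrite /u -mulrBl -natr1 opprD addrA subrr sub0r normrM normrN1 mul1r.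
    by rewrite ger0_norm // invr_ge0.
  - by rewrite last_rcons.
  move=> p; rewrite inE mem_rcons inE orbCA => /orP[/eqP ->|pL'].
    by exists (u m.+1) => //; exact: uI.
  by apply: LI; rewrite inE.
by have := chain n.+1 (leqnn _); rewrite u1.
Qed.

Lemma compact_far (K1 K2 : set (R * R)) : compact K1 -> compact K2 ->
  (forall p, K1 p -> K2 p -> False) ->
  exists2 e, 0 < e & forall p q, K1 p -> K2 q -> far_pts e p q.
Proof.
move=> c1 c2 dis.
have [K0|] := pselect (K1 `*` K2 !=set0); last first.
  move=> K0; exists 1 => // p q K1p K2q; exfalso; apply: K0.
  by exists (p, q).
have cf : {within K1 `*` K2, continuous (fun z : (R * R) * (R * R) => `|z.1 - z.2|)}.
  apply: continuous_subspaceT => z.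
  by apply: cvg_norm; apply: cvgB; [exact: cvg_fst|exact: cvg_snd].
have [[p q] /set_mem[/= K1p K2q] pqmin] := compact_EVT_min K0 (compact_setX c1 c2) cf.
have pq0 : 0 < `|p - q|.
  by rewrite normr_gt0 subr_eq0; apply/eqP => pq; apply: (dis p) => //; rewrite pq.
(* A third of the smallest distance, to match the factor 3 in [far_pts]. *)
exists (`|p - q| / 3); first by rewrite divr_gt0.
move=> p' q' K1p' K2q'; apply: far_pts_norm; rewrite mulrC divfK //.
by have := pqmin (p', q'); apply; rewrite inE.
Qed.

End Curves.

(** * Drawn edges as chains, at a common distance when disjoint *)

Section Embedding.
Import Order.TTheory GRing.Theory Num.Theory.
Import numFieldNormedType.Exports.
Local Open Scope ring_scope.
Local Open Scope set_scope.
Variables (R : realType) (V : finType) (adj : rel V).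
Variables (point : V -> R * R) (curve : {set V} -> R -> R * R).
Hypothesis emb : plane_embedding adj point curve.

Definition drawn_in (W : {set V}) (p : R * R) : Prop :=
  exists2 d, d \in edges adj & d \subset W /\ exists2 t : R, 0 <= t <= 1 & p = curve d t.

Lemma curve_end_in d : d \in edges adj ->
  (exists2 x, x \in d & curve d 0 = point x) /\
  (exists2 y, y \in d & curve d 1 = point y).
Proof.
move=> dE; have [x [y [-> c0 c1]]] := curve_ends emb dE.
by split; [exists x|exists y]; rewrite // !inE eqxx ?orbT.
Qed.

Lemma curves_disjoint d1 d2 (s t : R) : d1 \in edges adj -> d2 \in edges adj ->
  [disjoint d1 & d2] -> 0 <= s <= 1 -> 0 <= t <= 1 -> curve d1 s <> curve d2 t.
Proof.
move=> d1E d2E dis.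
have ptneq x y : x \in d1 -> y \in d2 -> point x <> point y.
  move=> xd yd /(point_inj emb) xy; subst y.
  by have /pred0P/(_ x)/= := dis; rewrite xd yd.
have ends d : d \in edges adj -> forall u : R, 0 <= u <= 1 ->
    0 < u < 1 \/ exists2 x, x \in d & curve d u = point x.
  move=> dE u /andP[]; have [e0 e1] := curve_end_in dE.
  rewrite !le_eqVlt => /orP[/eqP <- _|u0 /orP[/eqP ->|u1]]; [by right|by right|].
  by left; rewrite u0.
move=> /(ends _ d1E) [sI|[x xd ->]] /(ends _ d2E) [tI|[y yd ->]].
- apply: (curve_disjoint emb) => //; apply: contraTneq dis => ->.
  rewrite -setI_eq0 finset.setIid; apply/finset.set0Pn.
  by have [[x xd _] _] := curve_end_in d2E; exists x.
- exact: (curve_avoids_points emb).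
- by move=> /esym; apply: (curve_avoids_points emb).
- exact: ptneq.
Qed.

Lemma drawing_separated : exists2 e : R, 0 < e &
  forall W1 W2 : {set V}, [disjoint W1 & W2] -> forall p q,
    drawn_in W1 p -> drawn_in W2 q -> far_pts e p q.
Proof.
have pairE (d : {set V} * {set V}) : exists e : R, 0 < e /\ 
    (d.1 \in edges adj -> d.2 \in edges adj -> [disjoint d.1 & d.2] ->
    forall s t : R, 0 <= s <= 1 -> 0 <= t <= 1 -> far_pts e (curve d.1 s) (curve d.2 t)).
  have [/and3P[d1E d2E dis]|Nd] :=
    boolP [&& d.1 \in edges adj, d.2 \in edges adj & [disjoint d.1 & d.2]]; last first.
    by exists 1; split=> // H1 H2 H3; rewrite H1 H2 H3 in Nd.
  have cpt d' : d' \in edges adj -> compact (curve d' @` `[0, 1])%classic.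
    move=> d'E; apply: continuous_compact; first exact: (curve_continuous emb).
    exact: segment_compact.
  have [|e e0 eP] := compact_far (cpt _ d1E) (cpt _ d2E).
    move=> p [s /= sI <-] [t /= tI]; move: sI tI; rewrite !in_itv /= => sI tI /esym.
    exact: curves_disjoint.
  exists e; split=> // _ _ _ s t sI tI; apply: eP.
    by exists s; rewrite //= in_itv.
  by exists t; rewrite //= in_itv.
have [f fP] := choice pairE.
(* One distance for all pairs of edges: the minimum of finitely many positive numbers. *)
exists (\big[Num.min/1]_d f d).
  by apply: (big_ind (fun x : R => 0 < x)) => // [x y x0 y0|d _]; [rewrite lt_min x0|case: (fP d)].
move=> W1 W2 dis p q [d1 d1E [d1W [s sI ->]]] [d2 d2E [d2W [t tI ->]]].
have [fd0 fd] := fP (d1, d2).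
have := fd d1E d2E (disjointW d1W d2W dis) s t sI tI; rewrite /far_pts /=.
have le_f : \big[Num.min/1]_d f d <= f (d1, d2) by rewrite (bigD1 (d1, d2)) //= ge_min lexx.
by move=> /orP[] h; apply/orP; [left|right]; apply: le_trans h; rewrite ler_pM2l.
Qed.

Lemma adj_edge x y : adj x y -> [set x; y] \in edges adj.
Proof.
move=> xy; apply: (@imset_f _ _ (fun z : V * V => [set z.1; z.2]) _ (x, y)).
by rewrite inE.
Qed.

Lemma edge_chain (e : R) (W : {set V}) x y : 0 < e -> adj x y -> x \in W -> y \in W ->
  exists L, [/\ path (near_pts e) (point x) L, last (point x) L = point y &
    forall p, p \in point x :: L -> drawn_in W p].
Proof.
move=> e0 xy xW yW; set d := [set x; y].
have dE : d \in edges adj by exact: adj_edge.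
have dW : d \subset W by apply/fintype.subsetP => z; rewrite !inE => /orP[] /eqP ->.
have [L [pL lL LI]] := curve_chain e0 (curve_continuous emb dE).
have inW p : p \in curve d 0 :: L -> drawn_in W p.
  by move=> /LI[t tI pt]; exists d => //; split=> //; exists t.
have [u [v [duv c0 c1]]] := curve_ends emb dE.
have uv : u <> v.
  move=> uv; have := @curve_inj _ _ _ _ _ emb d dE 0 1.
  rewrite !in_itv /= !lexx !ler01 => /(_ isT isT); rewrite c0 c1 uv => /(_ erefl).
  by move/eqP; rewrite eq_sym oner_eq0.
have : x \in [set u; v] by rewrite -duv !inE eqxx.
have : y \in [set u; v] by rewrite -duv !inE eqxx orbT.
have : u \in d by rewrite duv !inE eqxx.
have : v \in d by rewrite duv !inE eqxx orbT.
rewrite !inE => vxy uxy yuv xuv.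
have [[ux vy]|[uy vx]] : (u = x /\ v = y) \/ (u = y /\ v = x).
  case/orP: uxy vxy => /eqP ue /orP[] /eqP ve;
    [by case: uv; rewrite ue ve|by left|by right|by case: uv; rewrite ue ve].
- by exists L; rewrite -ux -vy -c0 -c1.
(* The arc may be parametrized from [y] to [x]; its chain is then reversed. *)
exists (rev (belast (curve d 0) L)); rewrite -vx -uy -c0 -c1 -lL; split.
- by rewrite rev_path; rewrite (eq_path (e' := near_pts e)) // => p q; rewrite near_ptsC.
- by case: (L) => //= q L'; rewrite rev_cons last_rcons.
move=> p; rewrite -rev_rcons -lastI mem_rev; exact: inW.
Qed.

End Embedding.

(** * A plane graph has no K5 minor *)

Section Models.
Import Order.TTheory GRing.Theory Num.Theory.
Import numFieldNormedType.Exports.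
Local Open Scope ring_scope.
Local Open Scope set_scope.
Variables (R : realType) (V : finType) (adj : rel V).
Variables (point : V -> R * R) (curve : {set V} -> R -> R * R).
Hypothesis emb : plane_embedding adj point curve.
Hypothesis adj_sym : symmetric adj.

Lemma walk_chain (e : R) (W : {set V}) x p : 0 < e -> x \in W -> p != [::] ->
  path (adj_within adj W) x p ->
  exists L, [/\ path (near_pts e) (point x) L, last (point x) L = point (last x p) &
    forall q, q \in point x :: L -> drawn_in adj curve W q].
Proof.
move=> e0; elim: p x => // y p IHp x xW _ /= /andP[/and3P[xy _ yW] yp].
have [L [pL lL LW]] := edge_chain emb e0 xy xW yW.
have [->|p0] := eqVneq p [::]; first by exists L.
have [M [pM lM MW]] := IHp y yW p0 yp.
exists (L ++ M); split; first by rewrite cat_path pL lL.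
- by rewrite last_cat lL.
move=> q; rewrite -cat_cons mem_cat => /orP[/LW //|qM].
by apply: MW; rewrite inE qM orbT.
Qed.

Lemma branch_chain (e : R) (W : {set V}) x y : 0 < e -> branch adj W ->
  x \in W -> y \in W -> x != y ->
  exists L, [/\ path (near_pts e) (point x) L, last (point x) L = point y &
    forall q, q \in point x :: L -> drawn_in adj curve W q].
Proof.
move=> e0 /andP[_ /forall_inP/(_ x) cW] xW yW xy.
have /forall_inP/(_ y yW)/connectP[p xp yE] := cW xW.
rewrite yE; apply: walk_chain => //.
by apply: contraNneq xy => p0; rewrite yE p0.
Qed.

(** A vertex [c i] represents each branch set, and an edge of K5 becomes a chain drawn inside the
    connected union of two branch sets. Independent edges of K5 use disjoint unions, so their chains
    are far apart, against [K5_chains]. *)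
Lemma embedding_K5_free s : ~~ K5_model adj s.
Proof.
apply/negP => /and3P[/eqP s5 /allP brs pw].
have /pairwiseP pws := pw.
pose B i : {set V} := nth finset.set0 s i.
have BP i j : (i < j < 5)%N -> [disjoint B i & B j] && touch adj (B i) (B j).
  by move=> /andP[ij j5]; apply: (pws finset.set0) => //; rewrite !inE s5 // (ltn_trans ij).
have disB i j : (i < 5)%N -> (j < 5)%N -> i != j -> [disjoint B i & B j].
  move=> i5 j5; rewrite neq_ltn => /orP[ij|ji].
    by have := BP i j; rewrite ij j5 => /(_ isT)/andP[].
  by rewrite disjoint_sym; have := BP j i; rewrite ji i5 => /(_ isT)/andP[].
have brB i : (i < 5)%N -> branch adj (B i) by move=> i5; apply: brs; rewrite mem_nth ?s5.
have /choice[c cP] i : exists x, (i < 5)%N -> x \in B i.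
  case: (ltnP i 5) => i5; last first.
    have /andP[/finset.set0Pn[x _] _] := brB 0%N isT.
    by exists x.
  by have /andP[/finset.set0Pn[x xB] _] := brB i i5; exists x.
have [e e0 sep] := drawing_separated emb.
have c_neq i j : (i < j < 5)%N -> c i != c j.
  move=> ij; have /andP[dij _] := BP i j ij; have /andP[lij j5] := ij.
  apply/eqP => cij; have /pred0P/(_ (c i))/= := dij.
  by rewrite cP ?(ltn_trans lij) // cij cP.
have /choice[L LP] (ij : nat * nat) : exists L, (ij.1 < ij.2 < 5)%N ->
    [/\ path (near_pts e) (point (c ij.1)) L, last (point (c ij.1)) L = point (c ij.2) &
    forall q, q \in point (c ij.1) :: L -> drawn_in adj curve (B ij.1 :|: B ij.2) q].
  case: (boolP (ij.1 < ij.2 < 5)%N) => [ij5|]; last by exists [::].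
  have /andP[lij j5] := ij5; have i5 := ltn_trans lij j5.
  have [|||||M MP] := @branch_chain e (B ij.1 :|: B ij.2) (c ij.1) (c ij.2) => //.
  - by apply: branchU; rewrite ?brB //; have /andP[] := BP _ _ ij5.
  - by rewrite inE cP.
  - by rewrite inE (cP ij.2) ?orbT.
  - exact: c_neq.
  by exists M.
apply: (@K5_chains R e (point \o c) (fun i j => L (i, j))).
- by move=> i j ij; have [] := LP (i, j) ij.
- by move=> i j ij; have [] := LP (i, j) ij.
- by move=> i j ij /=; rewrite (inj_eq (point_inj emb)) c_neq.
move=> i j k l ij kl ijkl.
have [nik nil njk njl] : [/\ i != k, i != l, j != k & j != l].
  by move: ijkl; rewrite /= !inE !negb_or => /and4P[/and3P[_ -> ->] /andP[-> ->]].
have [_ _ Lij] := LP (i, j) ij; have [_ _ Lkl] := LP (k, l) kl.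
apply/allP => p /Lij pD; apply/allP => q /Lkl qD; apply: sep pD qD.
have /andP[lij j5] := ij; have /andP[lkl l5] := kl.
have i5 := ltn_trans lij j5; have k5 := ltn_trans lkl l5.
by rewrite -setI_eq0 finset.setIUl !finset.setIUr !finset.setU_eq0 !setI_eq0 !disB.
Qed.

End Models.

Theorem corollary2 (R : realType) (V : finType) (adj : rel V)
    (adj_sym : symmetric adj) (adj_irr : irreflexive adj)
    (V_ge3 : 3 <= #|V|) (adj_conn : graph_connected adj)
    (adj_planar : planar R adj) :
  edge_connectivity adj - 1 <= lambda3 adj /\
  lambda3 adj <= edge_connectivity adj.
Proof.
split; last exact: lambda3_le_edge_connectivity.
have [s [t stE]] := edges_ends adj (ltnW (ltnW V_ge3)).
have [point [curve emb]] := adj_planar.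
have le5 : edge_connectivity adj <= 5.
  rewrite leqNgt; apply/negP => gt5.
  have deg6 v : 5 < #|[set w | adj v w]%SET|.
    have [w wv] : exists w, w \in ~: [set v]%SET.
      by apply/finset.set0Pn; rewrite -card_gt0 cardsC1 -ltnS prednK ltnW // ltnW.
    apply: leq_trans gt5 (edge_connectivity_le_degree stE (w := w) adj_irr adj_sym _).
    by move: wv; rewrite !inE eq_sym.
  have [m] := K5_of_degree_ge6 adj_sym adj_irr V_ge3 deg6.
  by apply/negP; apply: embedding_K5_free emb adj_sym _.
(* The first goal concerns the default value of the minimum defining [lambda3]. *)
apply: leq_bigminn => [|S /eqP S3]; last exact: lambda_set_ge stE _ S3 le5.
by apply: leq_trans (leq_subr _ _) (bigminn_le_default _ _ _).
Qed.
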